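(* Let $T\subset\mathbb{R}$ be a time scale with $\sup T=\infty$, let $a\in T$ with $a>0$, and let $A(t)$, $t\in T$, be an $n\times n$ matrix-valued function on $T$ that is rd-continuous and regressive. Suppose that the integrals $$\int_a^\infty A(s)\,\Delta s\quad\text{and}\quad \int_a^\infty A(t)\left(\int_t^\infty A(s)\,\Delta s\right)\Delta t$$ are convergent and that the integral $$\int_a^\infty A(t)\left(\int_t^\infty A(s)\left(\int_s^\infty A(\tau)\,\Delta\tau\right)\Delta s\right)\Delta t$$ is absolutely convergent. Then the linear system $x^\Delta=A(t)x$, $t\in T$, is of class (S).
   Context: A time scale $T$ is a nonempty closed subset of $\mathbb{R}$; $\sigma(t)=\inf\{s\in T: s>t\}$ is the forward jump operator, $\mu(t)=\sigma(t)-t$ is the graininess, $x^\Delta$ is the delta (Hilger) derivative, and $\int\cdots\Delta s$ is the delta integral on $T$. Matrices and vectors have real entries. A matrix function is rd-continuous if it is continuous at right-dense points of $T$ and has finite left-sided limits at left-dense points of $T$. The matrix function $A$ is regressive if $I+\mu(t)A(t)$ is invertible for all $t\in T$. Improper integrals: $\int_a^\infty F(t)\,\Delta t$ is convergent if $\lim_{b\to\infty,\,b\in T}\int_a^b F(t)\,\Delta t$ exists and is finite. It is absolutely convergent if $\int_a^\infty |F(t)|\,\Delta t<\infty$, where $|\cdot|$ is a matrix norm. Class (S): the system $x^\Delta=A(t)x$ is said to be of class (S) if (i) every solution $x(t)$ has a (finite) limit $x_\infty$ as $t\to\infty$, $t\in T$, and (ii) for every constant vector $x_\infty\in\mathbb{R}^n$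 there is a solution $x(t)$ such that $x(t)\to x_\infty$ as $t\to\infty$. *)

(* Defs.v *)
(* MathComp / MathComp-Analysis.  Functions on a time scale [T : set R] are
   represented by total functions on [R]; every notion below only reads their
   values at points of [T]. *)
From HB Require Import structures.
From mathcomp Require Import all_boot all_order all_algebra.
From mathcomp Require Import all_classical all_reals all_analysis.

Set Implicit Arguments.
Unset Strict Implicit.
Unset Printing Implicit Defensive.

Import Order.TTheory GRing.Theory Num.Theory.
Import numFieldNormedType.Exports.

Local Open Scope classical_set_scope.
Local Open Scope ring_scope.

Definition time_scale (R : realType) (T : set R) : Prop :=
  T !=set0 /\ closed T.

Definition sup_infinite (R : realType) (T : set R) : Prop :=
  ereal_sup (EFin @` T) = +oo%E.

(* [inf] is only meaningful here when some point of [T] exceeds [t], which is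
   always the case when [sup T = +oo]. *)
Definition fjump (R : realType) (T : set R) (t : R) : R :=
  inf [set s | T s /\ t < s].

Definition bjump (R : realType) (T : set R) (t : R) : R :=
  sup [set s | T s /\ s < t].

Definition graininess (R : realType) (T : set R) (t : R) : R := fjump T t - t.

(* A maximum of [T] would need a special case; there is none when
   [sup T = +oo]. *)
Definition right_dense (R : realType) (T : set R) (t : R) : Prop :=
  T t /\ fjump T t = t.

(* The existence of a smaller point excludes a minimum of [T], at which the
   convention would be [bjump T t = t] although [t] is not left-dense. *)
Definition left_dense (R : realType) (T : set R) (t : R) : Prop :=
  [/\ T t, (exists2 s, T s & s < t) & bjump T t = t].

Definition rd_continuous (R : realType) (V : normedModType R) (T : set R)
    (f : R -> V) : Prop :=
  (forall t, right_dense T t -> f s @[s --> within T (nbhs t)] --> f t) /\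
  (forall t, left_dense T t -> cvg (f s @[s --> within T (at_left t)])).

Definition regressive (R : realType) (n : nat) (T : set R)
    (A : R -> 'M[R]_n) : Prop :=
  forall t, T t -> 1%:M + graininess T t *: A t \in unitmx.

Definition is_delta_derive (R : realType) (V : normedModType R) (T : set R)
    (f : R -> V) (t : R) (df : V) : Prop :=
  forall e : R, 0 < e -> \forall s \near t, T s ->
    `|f (fjump T t) - f s - (fjump T t - s) *: df| <= e * `|fjump T t - s|.

Definition delta_antiderivative (R : realType) (V : normedModType R)
    (T : set R) (f F : R -> V) : Prop :=
  forall t, T t -> is_delta_derive T F t (f t).

(* Cauchy delta integral: [F s - F r] for an antiderivative [F] of [f], which
   exists for every rd-continuous [f]; the value does not depend on [F].
   It is [0] by convention if [f] has no antiderivative. *)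
Definition delta_integral (R : realType) (V : normedModType R) (T : set R)
    (f : R -> V) (r s : R) : V :=
  xget 0 [set I : V | exists2 F, delta_antiderivative T f F & I = F s - F r].

Definition infty_in (R : realType) (T : set R) : set_system R :=
  within T (pinfty_nbhs R).

Definition delta_integral_oo_cvg (R : realType) (V : normedModType R)
    (T : set R) (f : R -> V) (r : R) : Prop :=
  cvg (delta_integral T f r b @[b --> infty_in T]).

Definition delta_integral_oo (R : realType) (V : normedModType R)
    (T : set R) (f : R -> V) (r : R) : V :=
  lim (delta_integral T f r b @[b --> infty_in T]).

(* Submultiplicativity is not required, so that both usual meanings of
   "matrix norm" are covered. *)
Definition matrix_norm (R : realType) (n : nat) (N : 'M[R]_n -> R) : Prop :=
  [/\ forall M, N M = 0 -> M = 0,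
      forall (c : R) M, N (c *: M) = `|c| * N M &
      forall M M', N (M + M') <= N M + N M'].

(* For a nonnegative integrand, being finite is the same as being convergent. *)
Definition delta_integral_oo_abs_cvg (R : realType) (n : nat)
    (N : 'M[R]_n -> R) (T : set R) (f : R -> 'M[R]_n) (r : R) : Prop :=
  delta_integral_oo_cvg T (fun t => N (f t)) r.

Definition delta_solution (R : realType) (n : nat) (T : set R)
    (A : R -> 'M[R]_n) (x : R -> 'cV[R]_n) : Prop :=
  forall t, T t -> is_delta_derive T x t (A t *m x t).

Definition class_S (R : realType) (n : nat) (T : set R)
    (A : R -> 'M[R]_n) : Prop :=
  (forall x, delta_solution T A x ->
     exists xoo : 'cV[R]_n, x t @[t --> infty_in T] --> xoo) /\
  (forall xoo : 'cV[R]_n, exists2 x, delta_solution T A x &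
     x t @[t --> infty_in T] --> xoo).

(* Main.v *)
Require Import Defs.
From HB Require Import structures.
From mathcomp Require Import all_boot all_order all_algebra.
From mathcomp Require Import all_classical all_reals all_analysis.
From mathcomp Require Import ring lra.

Set Implicit Arguments.
Unset Strict Implicit.
Unset Printing Implicit Defensive.

Import Order.TTheory GRing.Theory Num.Theory.
Import numFieldNormedType.Exports.

Local Open Scope classical_set_scope.
Local Open Scope ring_scope.

(** Write [B1 t] for the integral of [A] from [t] to infinity, [B2 t] for that
of [A B1], and [D = A B2].  Iterating the integral equation satisfied by a
fundamental matrix that tends to the identity gives the formal expansion
[1 - B1 + B2 - ...]; put [P = 1 - B1 + B2].  Since [P^Delta = A - A B1], the
substitution [x = P z] turns [x^Delta = A x] into
[P(sigma t) z^Delta = (A P - P^Delta) z = D z], and [P] tends to the identity,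
so for large [t] the new system has an absolutely integrable coefficient.

For such a system everything is elementary.  Choose [t0] so late that the
integral of the coefficient over [[t0, oo)] is at most 1/4.  By the mean value
inequality [delta_mvt], [z] stays within [`|z t0| / 3] of [z t0] and is Cauchy
([perturbation_limit]); so [z], and with it [x], has a limit, and the limit
vanishes only if [x t0 = 0] ([solutions_converge]).  Applied to a matrix
solution [Phi] on the whole time scale with [Phi t0 = 1], this says that the
limit of [Phi] is an injective, hence invertible, matrix, and multiplying
[Phi] on the right by constants produces every prescribed limit.

Three ingredients are needed besides this computation.

- Antiderivatives exist for rd-continuous functions.  This carries real
  weight, because [delta_integral] is [0] by convention in the absence of an
  antiderivative.  In the scalar case the antiderivative is the largest
  function whose increments over [[p, q)] are at most [q - p] times any upper
  bound of the integrand there, as in Perron's definition of the integral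
  ([rd_antiderivative_real]); matrices are treated entrywise.

- The matrix solution [Phi] exists on all of [T] ([global_solution]).  Picard
  iteration solves the equation forward from any starting point
  ([picard_solution]).  Backward iteration would fail, but regressivity makes
  a nonzero solution nonzero forever ([solution_zero_backward]), so forward
  solutions can be normalised at [t0] and glued.

- All norms on matrices are equivalent ([matrix_norm_ge]), which converts
  absolute convergence for an arbitrary matrix norm into absolute convergence
  for the maximum norm. *)

(** * Jump operators and induction on a time scale *)

Section jumps.
Variables (R : realType) (T : set R).
Hypotheses (Tcl : closed T) (Tunb : forall M : R, exists2 t, T t & M < t).

Let above_has_inf t : has_inf [set s | T s /\ t < s].
Proof.
split; first by have [s Ts ts] := Tunb t; exists s.
by exists t => s [_ /ltW].
Qed.

Lemma le_fjump t : t <= fjump T t.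
Proof. by apply: lb_le_inf; [exact: (above_has_inf t).1|move=> s [_ /ltW]]. Qed.

Lemma fjump_le t s : T s -> t < s -> fjump T t <= s.
Proof. by move=> Ts ts; apply: ge_inf => //; exact: (above_has_inf t).2. Qed.

Lemma fjump_adherent t e : 0 < e ->
  exists s, [/\ T s, t < s & s < fjump T t + e].
Proof.
move=> e0; have [s [Ts ts] sl] := inf_adherent e0 (above_has_inf t).
by exists s.
Qed.

Lemma closed_adherent x :
  (forall e : R, 0 < e -> exists2 s, T s & `|x - s| < e) -> T x.
Proof.
move=> h; apply: Tcl => B /nbhs_ballP[e /= e0 eB].
by have [s Ts xs] := h _ e0; exists s; split => //; apply: eB.
Qed.

Lemma fjump_in t : T (fjump T t).
Proof.
apply: closed_adherent => e e0.
have [s [Ts ts sl]] := fjump_adherent t e0; exists s => //.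
have ls := fjump_le Ts ts.
by rewrite distrC ger0_norm ?subr_ge0// ltrBlDl.
Qed.

Lemma right_dense_adherent t e : right_dense T t -> 0 < e ->
  exists s, [/\ T s, t < s & s < t + e].
Proof. by move=> [_ tE] /(fjump_adherent t); rewrite tE. Qed.

Lemma left_dense_adherent t e : left_dense T t -> 0 < e ->
  exists s, [/\ T s, t - e < s & s < t].
Proof.
move=> [Tt [s0 Ts0 s0t] tE] e0.
have hs : has_sup [set s | T s /\ s < t].
  by split; [exists s0|exists t => s [_ /ltW]].
have [s [Ts st] sl] := sup_adherent e0 hs.
by exists s; split => //; rewrite -[X in X - e]tE.
Qed.

Lemma fjump_cases t : T t -> t < fjump T t \/ right_dense T t.
Proof.
move=> Tt; have := le_fjump t; rewrite le_eqVlt => /orP[/eqP tE|]; last by left.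
by right; split.
Qed.

(** The principle that replaces compactness arguments: a property propagates
from [r] to all later points if it passes right-scattered points, spreads to
the right of right-dense points, and is inherited by left-dense points.  At
the supremum of the points up to which the property holds, one of the three
steps contradicts maximality. *)
Lemma time_scale_ind (P : R -> Prop) r : T r -> P r ->
  (forall t, T t -> r <= t -> t < fjump T t -> P t -> P (fjump T t)) ->
  (forall t, r <= t -> right_dense T t -> P t ->
     \forall s \near t, T s -> t < s -> P s) ->
  (forall t, r < t -> left_dense T t ->
     (forall s, T s -> r <= s -> s < t -> P s) -> P t) ->
  forall t, T t -> r <= t -> P t.
Proof.
move=> Tr Pr Pscat Prd Pld t1 Tt1 rt1; apply: contrapT => nP1.
pose S := [set t | [/\ T t, r <= t & forall p, T p -> r <= p -> p <= t -> P p]].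
have Sr : S r.
  split => // p _ rp pr; suff -> : p = r by [].
  by apply/eqP; rewrite eq_le rp pr.
have S1 s : S s -> s < t1.
  by move=> [_ _ Ps]; rewrite ltNge; apply/negP => t1s; apply/nP1/Ps.
have hS : has_sup S by split; [exists r|exists t1 => s /S1/ltW].
pose u := sup S.
have Su s : S s -> s <= u by move=> Ss; apply: ub_le_sup => //; exact: hS.2.
have Pbelow p : T p -> r <= p -> p < u -> P p.
  move=> Tp rp pu; have up0 : 0 < u - p by rewrite subr_gt0.
  have [s [_ _ Ps] ps] := sup_adherent up0 hS.
  by apply: Ps => //; apply: ltW; move: ps; rewrite -/u; lra.
have Tu : T u.
  apply: closed_adherent => e e0; have [s Ss us] := sup_adherent e0 hS.
  exists s; first by case: Ss.
  by rewrite ger0_norm ?subr_ge0 ?Su//; move: us; rewrite -/u; lra.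
have ru : r <= u by exact: Su.
have Pu : P u.
  move: ru; rewrite le_eqVlt => /orP[/eqP <- //|ru].
  apply: contrapT => nPu.
  have nSu : ~ S u by move=> [_ _ /(_ _ Tu (ltW ru) (lexx _))].
  have Slt s : S s -> s < u.
    move=> Ss; rewrite lt_neqAle Su// andbT; apply/eqP => su.
    by apply: nSu; rewrite -su.
  apply: nPu; apply: Pld => //; split => //; first by exists r.
  apply/eqP; rewrite eq_le; apply/andP; split.
    by apply: ge_sup => [|s [_ /ltW]//]; exists r.
  apply: ge_sup; first exact: hS.1.
  move=> s Ss; apply: ub_le_sup; first by exists u => z [_ /ltW].
  by split; [case: Ss|exact: Slt].
have SuS : S u.
  by split => // p Tp rp; rewrite le_eqVlt => /orP[/eqP -> //|]; exact: Pbelow.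
have [uj|du] := fjump_cases Tu.
  suff /Su : S (fjump T u) by rewrite leNgt uj.
  split; [exact: fjump_in|exact: le_trans ru (ltW uj)|].
  move=> p Tp rp; rewrite le_eqVlt => /orP[/eqP ->|pj]; first exact: Pscat.
  have [/(fjump_le Tp)|] := ltP u p; first by rewrite leNgt pj.
  by case: SuS => _ _; apply.
have /nbhs_ballP[d /= d0 dP] := Prd _ ru du Pu.
have [s [Ts us sd]] := right_dense_adherent du d0.
suff /Su : S s by rewrite leNgt us.
split => //; first by rewrite (le_trans ru)// ltW.
move=> p Tp rp ps; have [pu|up] := leP p u; first by case: SuS => _ _; apply.
apply: dP => //; rewrite /ball/= distrC ger0_norm ?subr_ge0 ?ltW//; lra.
Qed.

End jumps.

(** * Delta derivatives *)

Definition ts_cont (R : realType) (V : normedModType R) (T : set R)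
    (f : R -> V) (t : R) : Prop := f s @[s --> within T (nbhs t)] --> f t.

Lemma ts_contP (R : realType) (V : normedModType R) (T : set R)
    (f : R -> V) (t : R) :
  ts_cont T f t <->
  forall e : R, 0 < e -> \forall s \near t, T s -> `|f t - f s| <= e.
Proof.
split=> [/cvgrPdist_le h e e0|h]; first exact: h.
by apply/cvgrPdist_le => e e0; exact: h.
Qed.

Section delta_derivative.
Variables (R : realType) (V : normedModType R) (T : set R).
Hypotheses (Tcl : closed T) (Tunb : forall M : R, exists2 t, T t & M < t).
Implicit Types (f g : R -> V).

Local Notation sigma := (fjump T).

(** Evaluating the definition at [s = t] leaves an error [e * mu] for every
[e > 0]. *)
Lemma delta_derive_jump f t df : T t -> is_delta_derive T f t df ->
  f (sigma t) = f t + (sigma t - t) *: df.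
Proof.
move=> Tt fd; apply/eqP; rewrite -subr_eq0 -normr_le0 opprD addrA.
have mu0 : 0 <= sigma t - t by rewrite subr_ge0 le_fjump.
apply/ler_addgt0Pr => e e0; rewrite add0r.
have d0 : 0 < e / (sigma t - t + 1) by rewrite divr_gt0// ltr_wpDl.
have /nbhs_singleton /(_ Tt) h := fd _ d0.
apply: (le_trans h); rewrite ger0_norm// mulrAC ler_pdivrMr ?ltr_wpDl//.
by rewrite ler_wpM2l ?(ltW e0)// lerDl.
Qed.

Lemma delta_derive_cont f t df : T t -> is_delta_derive T f t df -> ts_cont T f t.
Proof.
move=> Tt fd; apply/ts_contP => e e0.
have mu0 : 0 <= sigma t - t by rewrite subr_ge0 le_fjump.
(* The error is at most [d * (mu + d) + d * `|df|], hence [d * C] for [d <= 1]. *)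
set C := sigma t - t + 1 + `|df|.
have C0 : 0 < C by rewrite /C -addrA ltr_wpDl// ltr_wpDr.
pose d := Num.min 1 (e / (2 * C)).
have d0 : 0 < d by rewrite lt_min ltr01/= divr_gt0// mulr_gt0.
have dC : d * C <= e / 2.
  have : d <= e / (2 * C) by rewrite ge_min lexx orbT.
  rewrite -(ler_pM2r C0) => /le_trans; apply.
  by rewrite invfM mulrA mulfVK// gt_eqF.
near=> s => Ts.
have st : `|t - s| < d.
  by near: s; apply: nbhsx_ballx.
have h : `|f (sigma t) - f s - (sigma t - s) *: df| <= d * `|sigma t - s|.
  by move: Ts; near: s; exact: fd.
have jE := delta_derive_jump Tt fd.
have -> : f t - f s = f (sigma t) - f s - (sigma t - s) *: df
    + (t - s) *: df.
  rewrite jE -[RHS]addrA -scaleNr -scalerDl.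
  have -> : - (sigma t - s) + (t - s) = - (sigma t - t) by lra.
  by rewrite [f t + _ - f s]addrAC -[RHS]addrA -scalerDl subrr scale0r addr0.
apply: (le_trans (ler_normD _ _)); rewrite normrZ.
have : `|sigma t - s| <= sigma t - t + `|t - s|.
  have -> : sigma t - s = (sigma t - t) + (t - s) by lra.
  by apply: (le_trans (ler_normD _ _)); rewrite (ger0_norm mu0).
have d1 : d <= 1 by rewrite ge_min lexx.
have := normr_ge0 df; have := normr_ge0 (t - s).
move: h dC; rewrite /C; nra.
Unshelve. all: by end_near. Qed.

(** Away from the jump the increment [sigma t - s] stays bounded below, so the
definition only asks for continuity. *)
Lemma is_delta_derive_scattered f t df : T t -> t < sigma t ->
  f (sigma t) - f t = (sigma t - t) *: df -> ts_cont T f t ->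
  is_delta_derive T f t df.
Proof.
move=> Tt tj fE /ts_contP fc e e0.
have mu0 : 0 < sigma t - t by rewrite subr_gt0.
set C := 1 + `|df|.
have C0 : 0 < C by rewrite ltr_wpDr.
pose d := e * (sigma t - t) / 2.
have d0 : 0 < d by rewrite divr_gt0// mulr_gt0.
have m0 : 0 < Num.min ((sigma t - t) / 2) (d / (2 * C)).
  by rewrite lt_min; apply/andP; split; rewrite divr_gt0// mulr_gt0.
near=> s => Ts.
have st : `|t - s| < Num.min ((sigma t - t) / 2) (d / (2 * C)).
  by near: s; apply: nbhsx_ballx.
have h : `|f t - f s| <= d / 2.
  by move: Ts; near: s; apply: fc; rewrite divr_gt0.
have -> : f (sigma t) - f s - (sigma t - s) *: df =
    f t - f s - (t - s) *: df.
  move/eqP: fE; rewrite subr_eq => /eqP ->.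
  rewrite [_ + f t]addrC -!addrA -!scaleNr; congr (_ + _).
  by rewrite addrCA -scalerDl; congr (_ + _ *: _); lra.
have {st} [s1 s2] : `|t - s| < (sigma t - t) / 2 /\ `|t - s| < d / (2 * C).
  by move: st; rewrite lt_min => /andP.
have s3 : `|t - s| * `|df| <= d / 2.
  have dC : d / (2 * C) * C = d / 2 by rewrite invfM mulrA mulfVK// gt_eqF.
  rewrite -dC; apply: ler_pM => //; first exact: ltW.
  by rewrite /C lerDr.
apply: (le_trans (ler_normB _ _)); rewrite normrZ.
have : (sigma t - t) / 2 <= `|sigma t - s|.
  have -> : sigma t - s = (sigma t - t) + (t - s) by lra.
  have := lerB_normD (sigma t - t) (t - s).
  rewrite (gtr0_norm mu0); lra.
move=> /(ler_wpM2l (ltW e0)) sj; have := lerD h s3; move: sj; rewrite /d. lra.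
Unshelve. all: by end_near. Qed.

Lemma is_delta_derive_cst (c : V) t : is_delta_derive T (cst c) t 0.
Proof.
move=> e e0; near=> s => _.
by rewrite subrr scaler0 subrr normr0 mulr_ge0// ltW.
Unshelve. all: by end_near. Qed.

Lemma is_delta_deriveD f g t df dg :
  is_delta_derive T f t df -> is_delta_derive T g t dg ->
  is_delta_derive T (f \+ g) t (df + dg).
Proof.
move=> fd gd e e0; have e20 : 0 < e / 2 by rewrite divr_gt0.
move: (fd _ e20) (gd _ e20); apply: filterS2 => s + + Ts.
move=> /(_ Ts) h1 /(_ Ts) h2.
rewrite /= scalerDr !opprD [f (sigma t) + g (sigma t) + _]addrACA [X in `|X|]addrACA.
apply: (le_trans (ler_normD _ _)); rewrite [in leRHS](splitr e) mulrDl.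
exact: lerD h1 h2.
Qed.

Lemma is_delta_deriveN f t df :
  is_delta_derive T f t df -> is_delta_derive T (\- f) t (- df).
Proof.
move=> fd e e0; move: (fd _ e0); apply: filterS => s + Ts.
by move=> /(_ Ts) /=; move: (sigma t) => j; rewrite scalerN -!opprD normrN.
Qed.

Lemma is_delta_deriveZ (c : R) f t df :
  is_delta_derive T f t df -> is_delta_derive T (c \*: f) t (c *: df).
Proof.
move=> fd e e0; have c0 : 0 < `|c| + 1 by rewrite ltr_wpDl.
have e1 : 0 < e / (`|c| + 1) by rewrite divr_gt0.
move: (fd _ e1); apply: filterS => s + Ts => /(_ Ts) /=.
move: (sigma t) => j h.
rewrite scalerA mulrC -scalerA -!scalerBr normrZ.
apply: (le_trans (ler_wpM2l (normr_ge0 c) h)).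
rewrite mulrA ler_wpM2r// mulrCA ler_piMr// ?(ltW e0)//.
by rewrite ler_pdivrMr// mul1r lerDl.
Qed.

Lemma is_delta_deriveB f g t df dg :
  is_delta_derive T f t df -> is_delta_derive T g t dg ->
  is_delta_derive T (f \- g) t (df - dg).
Proof. by move=> fd gd; exact: is_delta_deriveD fd (is_delta_deriveN gd). Qed.

Lemma is_delta_derive_near f g t df : T t -> f t = g t ->
  f (sigma t) = g (sigma t) ->
  (\forall s \near t, T s -> f s = g s) ->
  is_delta_derive T f t df -> is_delta_derive T g t df.
Proof.
move=> Tt ft fj fg fd e e0; move: fg (fd _ e0); apply: filterS2 => s + + Ts.
by move=> /(_ Ts) -> /(_ Ts); rewrite fj.
Qed.

End delta_derivative.

Lemma is_delta_derive_linear (R : realType) (T : set R) (c t : R) :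
  is_delta_derive T (fun s => c * s : R) t c.
Proof.
move=> e e0; near=> s => _ /=.
rewrite -mulrBr -[_ *: c]/(_ * c) [X in _ - X]mulrC subrr normr0.
by rewrite mulr_ge0// ltW.
Unshelve. all: by end_near. Qed.

(** * Mean value inequality and bounds on compact pieces *)

Section mean_value.
Variables (R : realType) (V : normedModType R) (T : set R).
Hypotheses (Tcl : closed T) (Tunb : forall M : R, exists2 t, T t & M < t).

Local Notation sigma := (fjump T).

(** Comparison of increments, by induction along the time scale for the
inequality weakened by a slack [e * (t - r)]; the slack absorbs the
differentiability errors at right-dense points, and [e] is arbitrary. *)
Lemma delta_mvt (f : R -> V) (g : R -> R) r s : T r -> T s -> r <= s ->
  (forall t, T t -> r <= t -> t <= s -> exists df dg,
    [/\ is_delta_derive T f t df, is_delta_derive T g t dg & `|df| <= dg]) ->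
  `|f s - f r| <= g s - g r.
Proof.
move=> Tr Ts rs fg; apply/ler_addgt0Pr => e0 e00.
pose e := e0 / (s - r + 1).
have e_gt0 : 0 < e by rewrite divr_gt0// ltr_wpDl// subr_ge0.
suff /(_ (lexx s)) h : s <= s -> `|f s - f r| <= g s - g r + e * (s - r).
  apply: (le_trans h); rewrite lerD2l /e mulrAC ler_pdivrMr ?ltr_wpDl ?subr_ge0//.
  by rewrite ler_wpM2l ?(ltW e00)// lerDl.
pose P t := t <= s -> `|f t - f r| <= g t - g r + e * (t - r).
apply: (@time_scale_ind R T Tcl Tunb P r) => //; rewrite /P.
- by move=> _; rewrite !subrr normr0 mulr0 addr0.
- move=> t Tt rt tj Pt js; have {}ts : t <= s by exact: le_trans (ltW tj) js.
  have [df [dg [fd gd dfg]]] := fg _ Tt rt ts.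
  rewrite (delta_derive_jump Tunb Tt fd) (delta_derive_jump Tunb Tt gd).
  rewrite addrAC (le_trans (ler_normD _ _))// normrZ.
  have mu0 : 0 <= sigma t - t by rewrite subr_ge0 ltW.
  rewrite (ger0_norm mu0) -[_ *: dg]/(_ * dg).
  have := Pt ts; have := ler_wpM2l mu0 dfg; have := mulr_ge0 (ltW e_gt0) mu0.
  set c := `|_|; nra.
- move=> t rt [Tt tE] Pt.
  have [ts|st] := leP t s; last first.
    by near=> p => _ tp ps; have := lt_trans (lt_le_trans tp ps) st; rewrite ltxx.
  have [df [dg [fd gd dfg]]] := fg _ Tt rt ts.
  have e4 : 0 < e / 4 by rewrite divr_gt0.
  have := fd _ e4; have := gd _ e4; apply: filterS2 => p + + Tp tp ps.
  move=> /(_ Tp) + /(_ Tp); rewrite tE => h1 h2.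
  have tp0 : 0 < p - t by rewrite subr_gt0.
  rewrite [`|t - p|]distrC (gtr0_norm tp0) in h1.
  rewrite [`|t - p|]distrC (gtr0_norm tp0) in h2.
  rewrite -[X in `|X - _|](subrK (f t)) -addrA.
  rewrite (le_trans (ler_normD _ _))//.
  have h3 : `|f p - f t| <= e / 4 * (p - t) + (p - t) * dg.
    have -> : f p - f t = - (f t - f p - (t - p) *: df) + (p - t) *: df.
      by rewrite opprB [RHS]addrAC -scalerDl addrA subrK subrr scale0r sub0r opprB.
    apply: (le_trans (ler_normD _ _)); rewrite normrN lerD//.
    by rewrite normrZ gtr0_norm// ler_wpM2l// ltW.
  have h4 : g p - g t >= (p - t) * dg - e / 4 * (p - t).
    move: h1; rewrite -[_ *: dg]/(_ * dg) ler_norml => /andP[h1 h1'].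
    lra.
  have := Pt ts; have := mulr_gt0 e_gt0 tp0; lra.
- move=> t rt ld Pl ts; have Tt : T t by case: ld.
  have [df [dg [fd gd _]]] := fg _ Tt (ltW rt) ts.
  have /ts_contP fc := delta_derive_cont Tunb Tt fd.
  have /ts_contP gc := delta_derive_cont Tunb Tt gd.
  apply/ler_addgt0Pr => d d0; have d2 : 0 < d / 2 by rewrite divr_gt0.
  have : \forall p \near t, T p -> `|f t - f p| <= d / 2 /\ `|g t - g p| <= d / 2.
    by have := fc _ d2; have := gc _ d2; apply: filterS2 => p + + Tp; split; auto.
  move=> /nbhs_ballP[b /= b0 hb].
  have m0 : 0 < Num.min b (t - r) by rewrite lt_min b0 subr_gt0.
  have [p [Tp tp pt]] := left_dense_adherent ld m0.
  have {}tp : t - p < Num.min b (t - r) by lra.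
  move: tp; rewrite lt_min => /andP[pb pr].
  have [] := hb p _ Tp; first by rewrite /ball/= gtr0_norm ?subr_gt0.
  move=> h1 h2.
  have rp : r <= p by lra.
  have h3 := Pl p Tp rp pt (le_trans (ltW pt) ts).
  have h4 : `|f t - f r| <= `|f t - f p| + `|f p - f r|.
    by rewrite -[X in `|X - _|](subrK (f p)) -addrA ler_normD.
  have : e * (p - r) <= e * (t - r) by rewrite ler_pM2l// lerD2r ltW.
  move: h2; rewrite ler_norml => /andP[h2 h2'].
  lra.
Unshelve. all: by end_near. Qed.

Lemma delta_mvt_le (f : R -> V) (M : R) r s p q :
  T p -> T q -> r <= p <= s -> r <= q <= s ->
  (forall t, T t -> r <= t -> t <= s ->
    exists2 df, is_delta_derive T f t df & `|df| <= M) ->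
  `|f p - f q| <= M * `|p - q|.
Proof.
wlog qp : p q / q <= p.
  move=> wl Tp Tq ps qs h; have [qp|/ltW pq] := leP q p; first exact: wl.
  by rewrite distrC [`|p - q|]distrC; exact: wl.
move=> Tp Tq /andP[rp ps] /andP[rq qs] h.
rewrite (ger0_norm (_ : 0 <= p - q)) ?subr_ge0// mulrBr.
apply: (@delta_mvt f (fun x => M * x) q p) => // t Tt qt tp.
have [df fd dfM] := h t Tt (le_trans rq qt) (le_trans tp ps).
by exists df, M; split => //; exact: is_delta_derive_linear.
Qed.

Lemma delta_derive0_cst (f : R -> V) :
  (forall t, T t -> is_delta_derive T f t 0) ->
  forall r s, T r -> T s -> f r = f s.
Proof.
move=> fd r s Tr Ts; apply/eqP; rewrite -subr_eq0 -normr_le0.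
have := @delta_mvt_le f 0 (Num.min r s) (Num.max r s) r s Tr Ts.
rewrite mul0r; apply; rewrite ?ge_min ?le_max ?lexx ?orbT//.
by move=> t Tt _ _; exists 0; [exact: fd|rewrite normr0].
Qed.

Lemma antiderivative_uniq (f F G : R -> V) : delta_antiderivative T f F ->
  delta_antiderivative T f G ->
  forall r s, T r -> T s -> F s - F r = G s - G r.
Proof.
move=> fF fG r s Tr Ts.
have h : F r - G r = F s - G s.
  apply: (@delta_derive0_cst (F \- G)) => // t Tt.
  by rewrite -(subrr (f t)); apply: is_delta_deriveB; [exact: fF|exact: fG].
by apply/eqP; rewrite subr_eq -addrA [- G r + _]addrC h addrCA subrr addr0.
Qed.

Lemma delta_integralE (f F : R -> V) : delta_antiderivative T f F ->
  forall r s, T r -> T s -> delta_integral T f r s = F s - F r.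
Proof.
move=> fF r s Tr Ts; rewrite /delta_integral.
case: xgetP => [I _ [G fG ->]|/(_ (F s - F r))]; last by case; exists F.
exact: (antiderivative_uniq fG fF).
Qed.

Lemma delta_integral_antiderivative (f F : R -> V) r : T r ->
  delta_antiderivative T f F -> delta_antiderivative T f (delta_integral T f r).
Proof.
move=> Tr fF t Tt; rewrite -[f t]subr0.
have := is_delta_deriveB (fF t Tt) (@is_delta_derive_cst R V T (F r) t).
apply: is_delta_derive_near => //=; try by rewrite (delta_integralE fF).
  by rewrite (delta_integralE fF) //; exact: fjump_in.
by near=> s => Ts; rewrite (delta_integralE fF).
Unshelve. all: by end_near. Qed.

(** rd-continuous functions need not be continuous, so boundedness on bounded
pieces is obtained by induction along the time scale instead of compactness:
one-sided limits are enough at dense points. *)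
Lemma rd_bounded (f : R -> V) r : rd_continuous T f -> T r ->
  forall b, T b -> r <= b ->
  exists2 M, 0 <= M & forall p, T p -> r <= p -> p <= b -> `|f p| <= M.
Proof.
move=> [frd fld] Tr.
apply: (@time_scale_ind R T Tcl Tunb _ r) => //.
- exists `|f r| => // p _ rp pr; suff -> : p = r by [].
  by apply/eqP; rewrite eq_le pr.
- move=> t Tt rt tj [M M0 hM]; exists (M + `|f (sigma t)|) => [|p Tp rp pj].
    by rewrite addr_ge0.
  have [pt|tp] := leP p t; first by rewrite ler_wpDr// hM.
  suff -> : p = sigma t by rewrite ler_wpDl.
  by apply/eqP; rewrite eq_le pj fjump_le.
- move=> t rt rdt [M M0 hM].
  have /cvgrPdist_le /(_ _ (@ltr01 R)) /nbhs_ballP[d /= d0 hd] := frd _ rdt.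
  near=> s => Ts tS; exists (M + (`|f t| + 1)) => [|p Tp rp ps].
    by rewrite !addr_ge0.
  have [pt|tp] := leP p t; first by rewrite ler_wpDr ?addr_ge0// hM.
  rewrite ler_wpDl//.
  have sd : `|t - s| < d by near: s; exact: nbhsx_ballx.
  have : `|f t - f p| <= 1.
    apply: hd => //; rewrite /ball/= (le_lt_trans _ sd)//.
    by rewrite !ltr0_norm ?subr_lt0//; lra.
  rewrite distrC; have := ler_normD (f p - f t) (f t); rewrite subrK; lra.
- move=> t rt ld hl; have /cvg_ex[l /cvgrPdist_le] := fld _ ld.
  move=> /(_ _ (@ltr01 R)) /nbhs_ballP[d /= d0 hd].
  have m0 : 0 < Num.min d (t - r) by rewrite lt_min d0 subr_gt0.
  have [s [Ts ts st]] := left_dense_adherent ld m0.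
  have {}ts : t - s < Num.min d (t - r) by lra.
  move: ts; rewrite lt_min => /andP[sd sr].
  have rs : r <= s by lra.
  have [M M0 hM] := hl s Ts rs st.
  exists (M + (`|l| + 1) + `|f t|) => [|p Tp rp pt].
    by rewrite !addr_ge0.
  have [ps|sp] := leP p s; first by rewrite -!addrA ler_wpDr ?addr_ge0// hM.
  move: pt; rewrite le_eqVlt => /orP[/eqP ->|pt].
    by rewrite ler_wpDl// !addr_ge0.
  have : `|l - f p| <= 1.
    by apply: hd => //; rewrite /ball/= gtr0_norm ?subr_gt0//; lra.
  rewrite distrC; have := ler_normD (f p - l) l; rewrite subrK.
  have := normr_ge0 (f t); lra.
Unshelve. all: by end_near. Qed.

Lemma ts_cont_left (f : R -> V) t : ts_cont T f t ->
  f s @[s --> within T (at_left t)] --> f t.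
Proof.
apply: cvg_trans; apply: cvg_app => B BT.
have {}BT : nbhs t [set s | T s -> B s] := BT.
change (nbhs t [set s | s < t -> T s -> B s]).
by apply: filterS BT => s h _.
Qed.

Lemma continuous_rd_continuous (f : R -> V) :
  (forall t, T t -> ts_cont T f t) -> rd_continuous T f.
Proof.
move=> fc; split=> [t [Tt _]|t [Tt _ _]]; first exact: fc.
by apply/cvg_ex; exists (f t); exact/ts_cont_left/fc.
Qed.

(** Gronwall's inequality in the form used below.  Let [M] be the supremum of
[`|x|] over the piece; increments of [x] are at most [M / 4], so
[M <= `|x c| + M / 4], and therefore [M / 4 <= `|x c| / 3].  It serves both
for uniqueness (where [x c = 0]) and for the asymptotics (where [c] is the
starting point). *)
Lemma small_growth_close (x : R -> V) (g : R -> R) r s :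
  (forall t, T t -> ts_cont T x t) -> T r -> T s -> r <= s ->
  (forall t, T t -> r <= t -> t <= s -> exists dx dg,
    [/\ is_delta_derive T x t dx, is_delta_derive T g t dg, 0 <= dg
      & `|dx| <= dg * `|x t|]) ->
  g s - g r <= 4^-1 ->
  forall p c, T p -> T c -> r <= p <= s -> r <= c <= s ->
  `|x p - x c| <= 3^-1 * `|x c|.
Proof.
move=> xc Tr Ts rs hx gsr p c Tp Tc prs crs.
have gmono u v : T u -> T v -> r <= u -> u <= v -> v <= s -> 0 <= g v - g u.
  move=> Tu Tv ru uv vs.
  have := @delta_mvt (cst 0) g u v Tu Tv uv; rewrite /cst subrr normr0; apply.
  move=> t Tt ut tv.
  have [dx [dg [_ gd dg0 _]]] := hx t Tt (le_trans ru ut) (le_trans tv vs).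
  by exists 0, dg; split => //; [exact: is_delta_derive_cst|rewrite normr0].
have [M0 M00 hM0] := rd_bounded (continuous_rd_continuous xc) Tr Ts rs.
pose S := [set y | exists u, [/\ T u, r <= u <= s & y = `|x u|]].
have hS : has_sup S.
  split; first by exists `|x r|, r; rewrite lexx rs.
  by exists M0 => y [u [Tu /andP[ru us] ->]]; exact: hM0.
pose M := sup S.
have leM u : T u -> r <= u -> u <= s -> `|x u| <= M.
  by move=> Tu ru us; apply: ub_le_sup; [exact: hS.2|exists u; rewrite ru us].
have M_ge0 : 0 <= M by rewrite (le_trans _ (leM _ Tr (lexx r) rs)).
have H u v : T u -> T v -> r <= u <= s -> r <= v <= s -> u <= v ->
    `|x v - x u| <= M / 4.
  move=> Tu Tv /andP[ru us] /andP[rv vs] uv.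
  apply: (@le_trans _ _ (M * g v - M * g u)).
    apply: (@delta_mvt x (fun t => M * g t)) => // t Tt ut tv.
    have ts := le_trans tv vs; have rt := le_trans ru ut.
    have [dx [dg [xd gd dg0 dxg]]] := hx t Tt rt ts.
    exists dx, (M * dg); split => //; last first.
      by rewrite (le_trans dxg)// mulrC ler_wpM2r// leM.
    exact: is_delta_deriveZ gd.
  rewrite -mulrBr ler_wpM2l// (le_trans _ gsr)//.
  have := gmono _ _ Tr Tu (lexx r) ru us; have := gmono _ _ Tv Ts rv vs (lexx s).
  lra.
have H' u v : T u -> T v -> r <= u <= s -> r <= v <= s -> `|x u - x v| <= M / 4.
  move=> Tu Tv us vs; have [uv|/ltW vu] := leP u v; last exact: H.
  by rewrite distrC; exact: H.
have : M <= `|x c| + M / 4.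
  apply: ge_sup; first exact: hS.1.
  move=> _ [u [Tu us ->]].
  have := H' u c Tu Tc us crs; have := ler_normD (x u - x c) (x c).
  by rewrite subrK; lra.
have := H' p c Tp Tc prs crs; lra.
Qed.

End mean_value.

(** * Antiderivatives of rd-continuous functions *)

Section perron.
Variables (R : realType) (T : set R) (f : R -> R).
Hypotheses (Tcl : closed T) (Tunb : forall M : R, exists2 t, T t & M < t).
Hypothesis frd : rd_continuous T f.

Local Notation sigma := (fjump T).

Definition subrate (r t : R) (G : R -> R) : Prop :=
  forall p q M, T p -> T q -> r <= p -> p <= q -> q <= t ->
    (forall u, T u -> p <= u -> u < q -> f u <= M) -> G q - G p <= M * (q - p).

(** The integral of [f] from [r] to [t], as a supremum: additivity and the
bounds of the integral by bounds of the integrand follow from the definition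
by gluing competitors, with no partition and no measurability question. *)
Definition perron (r t : R) : R :=
  sup [set y | exists2 G, subrate r t G & y = G t - G r].

Lemma subrate_linear r t m : (forall u, T u -> r <= u -> u < t -> m <= f u) ->
  subrate r t (fun x => m * x).
Proof.
move=> hm p q M Tp Tq rp pq qt hM; rewrite -mulrBr.
move: pq; rewrite le_eqVlt => /orP[/eqP ->|pq]; first by rewrite subrr !mulr0.
rewrite ler_wpM2r ?subr_ge0 ?(ltW pq)//.
by rewrite (le_trans (hm p Tp rp (lt_le_trans pq qt)))// hM.
Qed.

Let perron_has_sup r t : T r -> T t -> r <= t ->
  has_sup [set y | exists2 G, subrate r t G & y = G t - G r].
Proof.
move=> Tr Tt rt; have [M M0 hM] := rd_bounded Tcl Tunb frd Tr Tt rt.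
split.
  exists (- M * t - - M * r), (fun x => - M * x) => //.
  apply: subrate_linear => u Tu ru ut.
  by have := hM u Tu ru (ltW ut); rewrite ler_norml => /andP[].
exists (M * (t - r)) => _ [G hG ->].
apply: hG => // u Tu ru ut.
by have := hM u Tu ru (ltW ut); rewrite ler_norml => /andP[].
Qed.

Lemma perron_le r t M : T r -> T t -> r <= t ->
  (forall u, T u -> r <= u -> u < t -> f u <= M) -> perron r t <= M * (t - r).
Proof.
move=> Tr Tt rt hM; apply: ge_sup; first exact: (perron_has_sup Tr Tt rt).1.
by move=> _ [G hG ->]; exact: hG.
Qed.

Lemma perron_ge r t m : T r -> T t -> r <= t ->
  (forall u, T u -> r <= u -> u < t -> m <= f u) -> m * (t - r) <= perron r t.
Proof.
move=> Tr Tt rt hm; apply: ub_le_sup; first exact: (perron_has_sup Tr Tt rt).2.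
by exists (fun x => m * x); [exact: subrate_linear|rewrite mulrBr].
Qed.

Lemma perron_add r s t : T r -> T s -> T t -> r <= s -> s <= t ->
  perron r t = perron r s + perron s t.
Proof.
move=> Tr Ts Tt rs st; have rt := le_trans rs st.
apply/eqP; rewrite eq_le; apply/andP; split.
  apply: ge_sup; first exact: (perron_has_sup Tr Tt rt).1.
  move=> _ [G hG ->].
  rewrite -[G t](subrK (G s)) -addrA [leLHS]addrC lerD//.
    apply: ub_le_sup; first exact: (perron_has_sup Tr Ts rs).2.
    exists G => // p q M Tp Tq rp pq qs; apply: hG => //.
    exact: le_trans qs st.
  apply: ub_le_sup; first exact: (perron_has_sup Ts Tt st).2.
  exists G => // p q M Tp Tq sp; apply: hG => //.
  exact: le_trans rs sp.
(* Competitors on [[r, s]] and [[s, t]], both shifted to vanish at [s], glue. *)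
rewrite -lerBrDr; apply: ge_sup; first exact: (perron_has_sup Tr Ts rs).1.
move=> _ [G1 hG1 ->]; rewrite lerBrDr -lerBrDl.
apply: ge_sup; first exact: (perron_has_sup Ts Tt st).1.
move=> _ [G2 hG2 ->]; rewrite lerBrDl.
apply: ub_le_sup; first exact: (perron_has_sup Tr Tt rt).2.
exists (fun x => if x <= s then G1 x - G1 s else G2 x - G2 s); last first.
  rewrite rs; case: (leP t s) => [ts|_]; last by lra.
  have -> : t = s by apply/eqP; rewrite eq_le ts.
  by lra.
move=> p q M Tp Tq rp pq qt hM.
have [ps|sp] := leP p s; have [qs|sq] := leP q s.
- by rewrite opprB addrA subrK; apply: hG1.
- have h1 : G1 s - G1 p <= M * (s - p).
    by apply: hG1 => // u Tu pu us; apply: hM => //; exact: lt_trans us sq.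
  have h2 : G2 q - G2 s <= M * (q - s).
    apply: hG2 => //; first exact: ltW.
    by move=> u Tu su uq; apply: hM => //; exact: le_trans ps su.
  have -> : M * (q - p) = M * (q - s) + M * (s - p) by ring.
  lra.
- by have := lt_le_trans sp (le_trans pq qs); rewrite ltxx.
- by rewrite opprB addrA subrK; apply: hG2 => //; exact: ltW.
Qed.

(** At a right-dense point the integrand is within [e] of its value on a
neighbourhood, which bounds the difference quotient; at a right-scattered
point the jump is exact because [f] takes a single value before [sigma t], and
continuity follows from local boundedness. *)
Lemma rd_antiderivative_real : exists F : R -> R, delta_antiderivative T f F.
Proof.
have [r0 Tr0 _] := Tunb 0.
(* [T] may have no minimum, hence the signed integral from some [r0]. *)
pose F t := if r0 <= t then perron r0 t else - perron t r0.
have FE s t : T s -> T t -> s <= t -> F t - F s = perron s t.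
  move=> Ts Tt st; rewrite /F; case: (leP r0 s) => rs; case: (leP r0 t) => rt.
  - by rewrite (perron_add Tr0 Ts Tt rs st) addrAC subrr add0r.
  - by have := lt_le_trans rt (le_trans rs st); rewrite ltxx.
  - by rewrite (perron_add Ts Tr0 Tt (ltW rs) rt) opprK addrC.
  - by rewrite (perron_add Ts Tt Tr0 st (ltW rt)) opprK addrC addrK.
have FB s t m M : T s -> T t -> s <= t ->
    (forall u, T u -> s <= u -> u < t -> m <= f u <= M) ->
    m * (t - s) <= F t - F s <= M * (t - s).
  move=> Ts Tt st h; rewrite FE// perron_ge//= ?perron_le// => u Tu su ut.
    by have /andP[] := h u Tu su ut.
  by have /andP[] := h u Tu su ut.
exists F => t Tt.
have [tj|rdt] := fjump_cases Tunb Tt.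
  have Tj := fjump_in Tcl Tunb t.
  apply: is_delta_derive_scattered => //.
    have : f t * (sigma t - t) <= F (sigma t) - F t <= f t * (sigma t - t).
      apply: FB => //; first exact: ltW.
      move=> u Tu tu uj; suff -> : u = t by rewrite lexx.
      apply/eqP; rewrite eq_le tu andbT leNgt; apply/negP => /(fjump_le Tunb Tu).
      by rewrite leNgt uj.
    by rewrite -eq_le => /eqP <-; rewrite mulrC.
  have [[r Tr rt]|noleft] := pselect (exists2 r, T r & r < t); last first.
    apply/ts_contP => e e0.
    have m0 : 0 < sigma t - t by rewrite subr_gt0.
    near=> s => Ts; suff -> : s = t by rewrite subrr normr0 ltW.
    have : `|t - s| < sigma t - t by near: s; exact: nbhsx_ballx.
    rewrite ltr_norml => /andP[h1 h2].
    apply/eqP; rewrite eq_le; apply/andP; split; rewrite leNgt; apply/negP.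
      by move=> /(fjump_le Tunb Ts); lra.
    by move=> st; apply: noleft; exists s.
  have [M M0 hM] := rd_bounded Tcl Tunb frd Tr Tt (ltW rt).
  apply/ts_contP => e e0.
  have m0 : 0 < Num.min (sigma t - t) (Num.min (t - r) (e / (M + 1))).
    by rewrite !lt_min !subr_gt0 tj rt/= divr_gt0// ltr_wpDl.
  near=> s => Ts.
  have : `|t - s| < Num.min (sigma t - t) (Num.min (t - r) (e / (M + 1))).
    by near: s; exact: nbhsx_ballx.
  rewrite !lt_min => /and3P[].
  rewrite !ltr_norml => /andP[h1 h2] /andP[h3 h4] /andP[h5 h6].
  have st : s <= t by rewrite leNgt; apply/negP => /(fjump_le Tunb Ts); lra.
  have := @FB s t (- M) M Ts Tt st; rewrite mulNr -ler_norml => h7.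
  apply: (le_trans (h7 _)) => [u Tu su ut|].
    by rewrite -ler_norml hM//; lra.
  move: h6; rewrite ltr_pdivlMr ?ltr_wpDl// => h6.
  have : 0 <= t - s by rewrite subr_ge0.
  nra.
case: (rdt) => _ tE; case: frd => /(_ _ rdt) /ts_contP fc _ e e0.
have /nbhs_ballP[d /= d0 hd] := fc _ e0.
near=> s => Ts; rewrite tE -[_ *: _]/(_ * _).
have sd : `|t - s| < d by near: s; exact: nbhsx_ballx.
move: (sd); rewrite ltr_norml => /andP[h1 h2].
have fe u : T u -> `|t - u| < d -> f t - e <= f u <= f t + e.
  by move=> Tu ud; have := hd u ud Tu; rewrite ler_norml => /andP[? ?]; lra.
have [st|/ltW ts] := leP s t.
  have /(@FB s t (f t - e) (f t + e) Ts Tt st)/andP[h3 h4] :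
      forall u, T u -> s <= u -> u < t -> f t - e <= f u <= f t + e.
    by move=> u Tu su ut; apply: fe => //; rewrite ltr_norml; lra.
  by rewrite [`|t - s|]ger0_norm ?subr_ge0// ler_norml; lra.
have /(@FB t s (f t - e) (f t + e) Tt Ts ts)/andP[h3 h4] :
    forall u, T u -> t <= u -> u < s -> f t - e <= f u <= f t + e.
  by move=> u Tu su ut; apply: fe => //; rewrite ltr_norml; lra.
by rewrite [`|t - s|]ler0_norm ?subr_le0// ler_norml; lra.
Unshelve. all: by end_near. Qed.

End perron.

Section matrix_antiderivative.
Variables (R : realType) (m n : nat) (T : set R).
Hypotheses (Tcl : closed T) (Tunb : forall M : R, exists2 t, T t & M < t).

Lemma mx_norm_le_entries (M : 'M[R]_(m, n)) (e : R) : 0 <= e ->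
  (forall i j, `|M i j| <= e) -> `|M| <= e.
Proof.
move=> e0 h; rewrite [leLHS]/Num.norm/= mx_normrE.
by apply/bigmax_leP; split => // ij _; exact: h.
Qed.

Lemma entry_le_mx_norm (M : 'M[R]_(m, n)) i j : `|M i j| <= `|M|.
Proof.
rewrite [leRHS]/Num.norm/= mx_normrE.
exact: (le_bigmax _ (fun ij : 'I_m * 'I_n => `|M ij.1 ij.2|) (i, j)).
Qed.

Lemma rd_entry (f : R -> 'M[R]_(m, n)) i j :
  rd_continuous T f -> rd_continuous T (fun t => f t i j).
Proof.
move=> [frd fld]; split=> t ht.
  exact: cvg_comp (frd t ht) (@coord_continuous R m n i j (f t)).
have /cvg_ex[l fl] := fld t ht; apply/cvg_ex; exists (l i j).
exact: cvg_comp fl (@coord_continuous R m n i j l).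
Qed.

Lemma rd_antiderivative (f : R -> 'M[R]_(m, n)) : rd_continuous T f ->
  exists F : R -> 'M[R]_(m, n), delta_antiderivative T f F.
Proof.
move=> frd.
have /choice[F hF] : forall ij : 'I_m * 'I_n, exists F : R -> R,
    delta_antiderivative T (fun t => f t ij.1 ij.2) F.
  by move=> ij; apply: rd_antiderivative_real => //; exact: rd_entry.
exists (fun t => \matrix_(i, j) F (i, j) t) => t Tt e e0.
have : \forall s \near t, forall ij : 'I_m * 'I_n, T s ->
    `|F ij (fjump T t) - F ij s - (fjump T t - s) *: f t ij.1 ij.2|
      <= e * `|fjump T t - s|.
  by have := filter_forall _ (fun ij => @hF ij t Tt e e0); exact.
apply: filterS => s hs Ts; apply: mx_norm_le_entries => [|i j].
  by rewrite mulr_ge0// ltW.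
by rewrite !mxE; exact: (hs (i, j)).
Qed.

Lemma rd_delta_integral (f : R -> 'M[R]_(m, n)) r : T r -> rd_continuous T f ->
  delta_antiderivative T f (delta_integral T f r).
Proof.
move=> Tr /rd_antiderivative[F fF]; exact: delta_integral_antiderivative fF.
Qed.

End matrix_antiderivative.

(** * Products of matrix functions *)

Section matrix_products.
Variables (R : realType) (m n p : nat).

Lemma mx_norm_mulmx (A : 'M[R]_(m, n)) (B : 'M[R]_(n, p)) :
  `|A *m B| <= n%:R * `|A| * `|B|.
Proof.
apply: mx_norm_le_entries => [|i j]; first by rewrite !mulr_ge0.
rewrite mxE (le_trans (ler_norm_sum _ _ _))//.
apply: (@le_trans _ _ (\sum_(k < n) `|A| * `|B|)).
  by apply: ler_sum => k _; rewrite normrM ler_pM// entry_le_mx_norm.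
by rewrite sumr_const card_ord -mulrA mulr_natl.
Qed.

Lemma cvg_mulmx (U : Type) (F : set_system U) {FF : Filter F}
    (f : U -> 'M[R]_(m, n)) (g : U -> 'M[R]_(n, p))
    (a : 'M[R]_(m, n)) (b : 'M[R]_(n, p)) :
  f x @[x --> F] --> a -> g x @[x --> F] --> b ->
  (f x *m g x) @[x --> F] --> a *m b.
Proof.
move=> /cvgrPdist_le fa /cvgrPdist_le gb; apply/cvgrPdist_le => e e0.
pose C := n%:R * (`|a| + (`|b| + 1)) + 1.
have C0 : 0 < C by rewrite ltr_wpDl// mulr_ge0// !addr_ge0.
pose d := Num.min 1 (e / C).
have d0 : 0 < d by rewrite lt_min ltr01 divr_gt0.
have d1 : d <= 1 by rewrite ge_min lexx.
have dC : d * C <= e.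
  by rewrite -ler_pdivlMr// ge_min lexx orbT.
have := fa _ d0; have := gb _ d0; apply: filterS2 => x gx fx.
have -> : a *m b - f x *m g x = a *m (b - g x) + (a - f x) *m g x.
  by rewrite mulmxBr mulmxBl addrA subrK.
rewrite (le_trans (ler_normD _ _))//.
have h1 := mx_norm_mulmx a (b - g x); have h2 := mx_norm_mulmx (a - f x) (g x).
have gb1 : `|g x| <= `|b| + 1.
  have := ler_normB b (b - g x); rewrite subKr => /le_trans; apply.
  by rewrite lerD2l (le_trans gx).
have h3 : n%:R * `|a| * `|b - g x| <= n%:R * `|a| * d.
  by rewrite ler_wpM2l// mulr_ge0.
have h4 : n%:R * `|a - f x| * `|g x| <= n%:R * d * (`|b| + 1).
  by rewrite -!mulrA ler_wpM2l// ler_pM.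
move: dC h1 h2 h3 h4; rewrite /C; set N := n%:R; move: d0; nra.
Qed.

End matrix_products.

Lemma rd_mulmx (R : realType) (m n p : nat) (T : set R)
    (f : R -> 'M[R]_(m, n)) (g : R -> 'M[R]_(n, p)) :
  rd_continuous T f -> (forall t, T t -> ts_cont T g t) ->
  rd_continuous T (fun t => f t *m g t).
Proof.
move=> [frd fld] gc; split=> t ht.
  by apply: cvg_mulmx; [exact: frd|apply: gc; case: ht].
have /cvg_ex[l fl] := fld t ht; apply/cvg_ex; exists (l *m g t).
by apply: cvg_mulmx => //; apply: ts_cont_left; apply: gc; case: ht.
Qed.

(** * Exponential weights for Picard iteration *)

Section exponential_weight.
Variable R : realType.

(** The upper bound comes from [expR y <= (1 - y)^-1], the reciprocal of
[1 - y <= expR (- y)]. *)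
Lemma expR_quadratic (y : R) : `|y| <= 2^-1 ->
  `|expR y - 1 - y| <= 2 * y ^+ 2.
Proof.
rewrite ler_norml => /andP[y1 y2].
have h1 := expR_ge1Dx y; have h2 := expR_ge1Dx (- y).
have h3 : expR y * expR (- y) = 1 by rewrite -expRD subrr expR0.
have h4 := expR_gt0 y; have h5 := expR_gt0 (- y).
have h6 : expR y * (1 - y) <= 1 by rewrite -[leRHS]h3 ler_wpM2l// ltW.
rewrite ler_norml; apply/andP; split; first by nra.
have y0 : 0 < 1 - y by lra.
rewrite -subr_ge0 -(pmulr_rge0 _ y0).
have -> : (1 - y) * (2 * y ^+ 2 - (expR y - 1 - y)) =
  (1 - expR y * (1 - y)) + y ^+ 2 * (1 - 2 * y) by ring.
by rewrite addr_ge0 ?subr_ge0// mulr_ge0 ?sqr_ge0// subr_ge0; lra.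
Qed.

(** By convexity the exponential grows on a time scale at least as fast as on
the line.  It serves as a majorant in [delta_mvt], hence the lower bound on its
delta derivative. *)
Lemma exp_delta_derive (T : set R) (Tunb : forall M : R, exists2 t, T t & M < t)
  (c r t : R) : T t ->
  exists2 w, is_delta_derive T (fun s => expR (c * (s - r))) t w
    & c * expR (c * (t - r)) <= w.
Proof.
move=> Tt; pose E s := expR (c * (s - r)).
have E0 s : 0 < E s by exact: expR_gt0.
have EM s : E s = E t * expR (c * (s - t)).
  by rewrite /E -expRD; congr expR; ring.
have Ed e : 0 < e -> \forall s \near t,
    `|E t - E s - (t - s) * (c * E t)| <= e * `|t - s|.
  move=> e0.
  pose C := 2 * c ^+ 2 * E t + 1.
  have C0 : 0 < C by rewrite ltr_wpDl// pmulr_lge0// mulr_ge0// sqr_ge0.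
  pose D := 2 * (`|c| + 1).
  have D0 : 0 < D by rewrite mulr_gt0// ltr_wpDl.
  have m0 : 0 < Num.min D^-1 (e / C) by rewrite lt_min invr_gt0 D0 divr_gt0.
  near=> s.
  have : `|t - s| < Num.min D^-1 (e / C) by near: s; exact: nbhsx_ballx.
  rewrite lt_min => /andP[sD]; rewrite ltr_pdivlMr// => sC.
  have yh : `|c * (s - t)| <= 2^-1.
    rewrite normrM distrC; move: sD; rewrite -[X in _ < X]mul1r ltr_pdivlMr//.
    by rewrite /D; have := normr_ge0 (t - s); nra.
  have -> : E t - E s - (t - s) * (c * E t) =
      - (E t * (expR (c * (s - t)) - 1 - c * (s - t))) by rewrite (EM s); ring.
  rewrite normrN normrM gtr0_norm//.
  have := ler_wpM2l (ltW (E0 t)) (expR_quadratic yh) => /le_trans; apply.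
  have -> : E t * (2 * (c * (s - t)) ^+ 2) =
      (2 * c ^+ 2 * E t * `|t - s|) * `|t - s|.
    by rewrite -[RHS]mulrA -expr2 real_normK ?num_real//; ring.
  rewrite ler_wpM2r// (le_trans _ (ltW sC))// mulrC ler_wpM2l// /C.
  by rewrite lerDl.
have [tj|[_ tE]] := fjump_cases Tunb Tt; last first.
  exists (c * E t) => // e e0; rewrite tE; apply: filterS (Ed _ e0) => s + _.
  exact.
have mu0 : 0 < fjump T t - t by rewrite subr_gt0.
exists ((fjump T t - t)^-1 * (E (fjump T t) - E t)).
  apply: is_delta_derive_scattered => //.
    by rewrite -[RHS]/(_ * _) mulrA divff ?gt_eqF// mul1r.
  apply/ts_contP => e e0.
  pose C := 1 + `|c * E t|.
  have C0 : 0 < C by rewrite ltr_wpDr.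
  near=> s => _.
  have h1 : `|E t - E s - (t - s) * (c * E t)| <= 1 * `|t - s|.
    by near: s; exact: Ed.
  have h2 : `|t - s| < e / C by near: s; apply: nbhsx_ballx; rewrite divr_gt0.
  have -> : E t - E s = E t - E s - (t - s) * (c * E t) + (t - s) * (c * E t).
    by rewrite subrK.
  rewrite (le_trans (ler_normD _ _))//.
  rewrite [`|(t - s) * _|]normrM; move: h1 h2; rewrite ltr_pdivlMr// /C mul1r.
  move: `|c * E t| => v; move: `|_ - _ - _| => u; rewrite mulrDr; lra.
rewrite ler_pdivlMl// (EM (fjump T t)).
rewrite -/(E t); have := ler_wpM2l (ltW (E0 t)) (expR_ge1Dx (c * (fjump T t - t))).
rewrite mulrDr mulr1.
have -> : (fjump T t - t) * (c * E t) = E t * (c * (fjump T t - t)) by ring.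
lra.
Unshelve. all: by end_near. Qed.

Lemma halfpow_small (C e : R) : 0 <= C -> 0 < e ->
  exists k0, forall k, (k0 <= k)%N -> C * 2^-1 ^+ k <= e.
Proof.
move=> C0 e0; have Ce : 0 <= C / e by rewrite divr_ge0// ltW.
exists (Num.bound (C / e)) => k bk.
rewrite exprVn ler_pdivrMr ?exprn_gt0// -ler_pdivrMl// mulrC.
rewrite (le_trans (ltW (archi_boundP Ce)))//.
by rewrite -natrX ler_nat (leq_trans bk)// ltnW// ltn_expl.
Qed.

End exponential_weight.

(** * Forward solutions of the linear equation *)

Definition delta_solution_mx (R : realType) (n m : nat) (T : set R)
    (A : R -> 'M[R]_n) (X : R -> 'M[R]_(n, m)) : Prop :=
  forall t, T t -> is_delta_derive T X t (A t *m X t).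

Lemma le_halfpow_le0 (R : realType) (C y : R) : 0 <= C ->
  (forall k, y <= C * 2^-1 ^+ k) -> y <= 0.
Proof.
move=> C0 h; apply/ler_addgt0Pr => e e0; rewrite add0r.
have [k0 hk] := halfpow_small C0 e0.
exact: le_trans (h k0) (hk k0 (leqnn _)).
Qed.

Section picard.
Variables (R : realType) (n : nat) (T : set R) (r : R) (A : R -> 'M[R]_n).
Hypotheses (Tcl : closed T) (Tunb : forall M : R, exists2 t, T t & M < t).
Hypotheses (Tr : T r) (rmin : forall t, T t -> r <= t).
Hypothesis Ard : rd_continuous T A.

Fixpoint picard (k : nat) : R -> 'M[R]_n :=
  if k is k'.+1
  then fun t => 1%:M + delta_integral T (fun s => A s *m picard k' s) r t
  else cst 1%:M.

Arguments picard : simpl never.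

Let int_derive (X : R -> 'M[R]_n) : (forall t, T t -> ts_cont T X t) ->
  forall t, T t ->
  is_delta_derive T (fun t => 1%:M + delta_integral T (fun s => A s *m X s) r t)
    t (A t *m X t).
Proof.
move=> Xc t Tt; rewrite -[_ *m _]add0r.
apply: is_delta_deriveD; first exact: is_delta_derive_cst.
exact: (rd_delta_integral Tcl Tunb Tr (rd_mulmx Ard Xc) Tt).
Qed.

Let int0 (X : R -> 'M[R]_n) : (forall t, T t -> ts_cont T X t) ->
  delta_integral T (fun s => A s *m X s) r r = 0.
Proof.
move=> Xc; have Xrd := rd_mulmx Ard Xc.
by rewrite (delta_integralE Tcl Tunb (rd_delta_integral Tcl Tunb Tr Xrd))// subrr.
Qed.

Let picard_cont k t : T t -> ts_cont T (picard k) t.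
Proof.
elim: k t => [|k IH] t Tt; first exact: cvg_cst.
exact: (delta_derive_cont Tunb Tt (int_derive IH Tt)).
Qed.

Let picard_derive k t : T t ->
  is_delta_derive T (picard k.+1) t (A t *m picard k t).
Proof. by move=> Tt; apply: int_derive => // s Ts; exact: picard_cont. Qed.

Let picard_r k : picard k r = 1%:M.
Proof.
case: k => // k.
rewrite -[LHS]/(1%:M + delta_integral T (fun s => A s *m picard k s) r r).
by rewrite int0 ?addr0// => t Tt; exact: picard_cont.
Qed.

Let mx_norm1 : `|1%:M : 'M[R]_n| <= 1.
Proof.
apply: mx_norm_le_entries => // i j; rewrite mxE.
by case: (i == j); rewrite ?normr1// normr0.
Qed.

Let Abound b : T b -> exists2 K : R, 0 <= K &
  forall t (M : 'M[R]_n), T t -> t <= b -> `|A t *m M| <= K * `|M|.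
Proof.
move=> Tb; have [K0 K00 hK] := rd_bounded Tcl Tunb Ard Tr Tb (rmin Tb).
exists (n%:R * K0) => [|t M Tt tb]; first by rewrite mulr_ge0.
rewrite (le_trans (mx_norm_mulmx _ _))// ler_wpM2r// ler_wpM2l//.
by apply: hK => //; exact: rmin.
Qed.

(** The iteration contracts by a factor 2 in the norm weighted by
[expR (- 2 K (t - r))]: integrating [K] times the weight gains [1 / 2]. *)
Let picard_step b : T b -> exists2 E : R, 0 <= E &
  forall k t, T t -> t <= b ->
    `|picard k.+1 t - picard k t| <= E * 2^-1 ^+ k.+1.
Proof.
move=> Tb; have [K K0 hK] := Abound Tb.
exists (expR (2 * K * (b - r))) => [|k t Tt tb]; first exact: expR_ge0.
have : forall t, T t -> t <= b ->
    `|picard k.+1 t - picard k t| <= 2^-1 ^+ k.+1 * expR (2 * K * (t - r)).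
  elim: k => [|k IH] {t Tt tb} t Tt tb.
    have ex u : T u -> u <= t -> exists df dg,
       [/\ is_delta_derive T (picard 1) u df,
           is_delta_derive T (2^-1 \*: (fun s => expR (2 * K * (s - r)))) u dg
         & `|df| <= dg].
      move=> Tu ut.
      have [w wd wge] := exp_delta_derive Tunb (2 * K) r Tu.
      exists (A u *m 1%:M), (2^-1 *: w); split.
      - exact: (@picard_derive 0%N).
      - exact: is_delta_deriveZ.
      rewrite (le_trans (hK _ _ Tu (le_trans ut tb)))//.
      rewrite (@le_trans _ _ (2^-1 * (2 * K * expR (2 * K * (u - r)))))//.
        rewrite -!mulrA mulKf// ler_wpM2l//.
        rewrite (le_trans mx_norm1)// -expR0 ler_expR mulr_ge0 ?mulr_ge0//.
        by rewrite subr_ge0 rmin.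
      by rewrite ler_wpM2l.
    have := @delta_mvt _ _ _ Tcl Tunb _ _ r t Tr Tt (rmin Tt)
      (fun u Tu _ ut => ex u Tu ut).
    rewrite picard_r expr1 [picard 0 t]/(1%:M) => /le_trans; apply.
    by rewrite /= gerBl mulr_ge0// expR_ge0.
  have ex u : T u -> u <= t -> exists df dg,
     [/\ is_delta_derive T (picard k.+2 \- picard k.+1) u df,
         is_delta_derive T (2^-1 ^+ k.+2 \*: (fun s => expR (2 * K * (s - r)))) u dg
       & `|df| <= dg].
    move=> Tu ut.
    have [w wd wge] := exp_delta_derive Tunb (2 * K) r Tu.
    exists (A u *m picard k.+1 u - A u *m picard k u), (2^-1 ^+ k.+2 *: w); split.
    - by apply: is_delta_deriveB; exact: picard_derive.
    - exact: is_delta_deriveZ.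
    rewrite -mulmxBr (le_trans (hK _ _ Tu (le_trans ut tb)))//.
    rewrite (@le_trans _ _ (2^-1 ^+ k.+2 * (2 * K * expR (2 * K * (u - r)))))//.
      rewrite exprSr -!mulrA mulKf// mulrCA ler_wpM2l//.
      by rewrite (mulrA 2 K); apply: IH => //; exact: le_trans ut tb.
    by rewrite ler_wpM2l// exprn_ge0.
  have := @delta_mvt _ _ _ Tcl Tunb _ _ r t Tr Tt (rmin Tt)
    (fun u Tu _ ut => ex u Tu ut).
  rewrite /= !picard_r [1%:M - _]subrr subr0 => /le_trans; apply.
  by rewrite gerBl mulr_ge0 ?expR_ge0// exprn_ge0.
move=> /(_ t Tt tb) /le_trans; apply.
rewrite mulrC ler_wpM2r ?exprn_ge0// ler_expR ler_wpM2l ?mulr_ge0//.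
by rewrite lerD2r.
Qed.

Let picard_close b : T b -> exists2 E : R, 0 <= E &
  forall k m t, T t -> t <= b -> (k <= m)%N ->
    `|picard m t - picard k t| <= E * 2^-1 ^+ k.
Proof.
move=> Tb; have [E E0 hE] := picard_step Tb; exists E => // k m t Tt tb km.
suff : `|picard m t - picard k t| <= E * (2^-1 ^+ k - 2^-1 ^+ m).
  move/le_trans; apply; rewrite ler_wpM2l// gerBl exprn_ge0//.
rewrite -(subnK km); elim: (m - k)%N => [|j IH].
  by rewrite add0n !subrr normr0 mulr0.
rewrite addSn -[X in `|X - _|](subrK (picard (j + k) t)) -addrA.
rewrite (le_trans (ler_normD _ _))//.
have := hE (j + k)%N t Tt tb; rewrite exprS; lra.
Qed.

Let X t := lim (picard k t @[k --> \oo]).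

Let picard_cvg t : T t -> picard k t @[k --> \oo] --> X t.
Proof.
move=> Tt; have [E E0 hE] := picard_close Tt.
suff : cvg (picard k t @[k --> \oo]) by [].
apply: cauchy_cvg; apply: cauchy_exP => e e0.
have e2 : 0 < e / 2 by rewrite divr_gt0.
have [k0 hk] := halfpow_small E0 e2.
exists (picard k0 t); exists k0 => // m /= k0m.
rewrite -ball_normE /ball_/= distrC (le_lt_trans (hE _ _ _ Tt (lexx t) k0m))//.
by rewrite (le_lt_trans (hk _ (leqnn _)))// ltr_pdivrMr// ltr_pMr// ltr1n.
Qed.

Let X_close b : T b -> exists2 E : R, 0 <= E &
  forall k t, T t -> t <= b -> `|X t - picard k t| <= E * 2^-1 ^+ k.
Proof.
move=> Tb; have [E E0 hE] := picard_close Tb; exists E => // k t Tt tb.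
apply/ler_addgt0Pr => e e0.
have /cvgrPdist_le /(_ _ e0) [m0 _ hm] := picard_cvg Tt.
have h1 := hm (maxn m0 k) (leq_maxl _ _).
have h2 := hE k (maxn m0 k) t Tt tb (leq_maxr _ _).
rewrite -[X in `|X - _|](subrK (picard (maxn m0 k) t)) -addrA.
by rewrite (le_trans (ler_normD _ _))// [leRHS]addrC lerD.
Qed.

Let X_cont t : T t -> ts_cont T X t.
Proof.
move=> Tt; have [b Tb tb] := Tunb (t + 1).
have [E E0 hE] := X_close Tb.
apply/ts_contP => e e0; have e3 : 0 < e / 3 by rewrite divr_gt0.
have [k hk] := halfpow_small E0 e3.
have hk' s : T s -> s <= b -> `|X s - picard k s| <= e / 3.
  by move=> Ts sb; rewrite (le_trans (hE _ _ _ _))// hk.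
have /ts_contP /(_ _ e3) := @picard_cont k t Tt.
move=> pc; near=> s => Ts.
have h1 : `|picard k t - picard k s| <= e / 3 by move: Ts; near: s.
have st : `|t - s| < 1 by near: s; exact: nbhsx_ballx.
have h2 := hk' t Tt _; have h3 : `|X s - picard k s| <= e / 3.
  by apply: hk' => //; move: st; rewrite ltr_norml => /andP[]; lra.
rewrite -[X in `|X - _|](subrK (picard k t)) -addrA.
rewrite (le_trans (ler_normD _ _))// (splitr e).
have -> : picard k t - X s = (picard k t - picard k s) - (X s - picard k s).
  by rewrite opprB addrA subrK.
have := ler_normB (picard k t - picard k s) (X s - picard k s).
have : `|X t - picard k t| <= e / 3 by apply: hk' => //; lra.
lra.
Unshelve. all: by end_near. Qed.

(** The limit [X] of the iterates is continuous, so [Y := 1 + int A X] is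
differentiable with derivative [A X]; and [Y = X] because [Y] is within
[O(2^-k)] of the iterate of index [k + 1]. *)
Lemma picard_solution : exists2 Y : R -> 'M[R]_n, delta_solution_mx T A Y & Y r = 1%:M.
Proof.
pose Y t := 1%:M + delta_integral T (fun s => A s *m X s) r t.
have Yd t : T t -> is_delta_derive T Y t (A t *m X t) by exact: int_derive.
have Yr : Y r = 1%:M by rewrite /Y int0 ?addr0.
exists Y => // t Tt.
suff -> : Y t = X t by exact: Yd.
have [K K0 hK] := Abound Tt; have [E E0 hE] := X_close Tt.
apply/eqP; rewrite -subr_eq0 -normr_le0.
have C0 : 0 <= K * E * (t - r) + E.
  by rewrite addr_ge0// !mulr_ge0// subr_ge0 rmin.
apply: (le_halfpow_le0 C0) => k.
have h1 : `|Y t - picard k.+1 t| <= K * E * (t - r) * 2^-1 ^+ k.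
  have := @delta_mvt_le _ _ _ Tcl Tunb (Y \- picard k.+1) (K * E * 2^-1 ^+ k)
    r t t r Tt Tr.
  rewrite /= picard_r Yr [1%:M - _]subrr subr0 lexx rmin//.
  rewrite ger0_norm ?subr_ge0 ?rmin// [leRHS]mulrAC; apply => // u Tu ru ut.
  exists (A u *m X u - A u *m picard k u).
    by apply: is_delta_deriveB; [exact: Yd|exact: picard_derive].
  rewrite -mulmxBr (le_trans (hK _ _ Tu ut))// -mulrA ler_wpM2l//.
  exact: hE.
have h2 := hE k.+1 t Tt (lexx t).
have h3 : E * 2^-1 ^+ k.+1 <= E * 2^-1 ^+ k.
  by rewrite ler_wpM2l// exprS ler_piMl ?exprn_ge0// invf_le1// ler1n.
have -> : Y t - X t = (Y t - picard k.+1 t) - (X t - picard k.+1 t).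
  by rewrite opprB addrA subrK.
rewrite (le_trans (ler_normB _ _))// mulrDl lerD//.
exact: le_trans h2 h3.
Qed.

End picard.

(** * Zeros of solutions *)

Section zeros_of_solutions.
Variables (R : realType) (n m : nat) (T : set R) (A : R -> 'M[R]_n).
Hypotheses (Tcl : closed T) (Tunb : forall M : R, exists2 t, T t & M < t).
Hypotheses (Ard : rd_continuous T A) (Areg : regressive T A).
Variable X : R -> 'M[R]_(n, m).
Hypothesis solX : delta_solution_mx T A X.

Let X_cont t : T t -> ts_cont T X t.
Proof. by move=> Tt; exact: (delta_derive_cont Tunb Tt (solX Tt)). Qed.

(** Where [A] is bounded by a constant, zeros propagate over a fixed distance in
both directions; only jumps distinguish forward from backward. *)
Lemma solution_zero_near r b : T r -> T b -> r <= b ->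
  exists2 d : R, 0 < d & forall c p, T c -> T p -> r <= c <= b -> r <= p <= b ->
    `|c - p| <= d -> X c = 0 -> X p = 0.
Proof.
move=> Tr Tb rb; have [K K0 hK] := rd_bounded Tcl Tunb Ard Tr Tb rb.
pose L := n%:R * K; have L0 : 0 <= L by rewrite mulr_ge0.
(* [L * d <= 1 / 4] is what [small_growth_close] asks of the growth [L * t]. *)
exists (4^-1 / (L + 1)) => [|c p Tc Tp /andP[rc cb] /andP[rp pb] cp Xc].
  by rewrite divr_gt0// ltr_wpDl.
pose u := Num.min c p; pose v := Num.max c p.
have Tu : T u by rewrite /u; case: leP.
have Tv : T v by rewrite /v; case: leP.
have uv : u <= v by rewrite /u /v ge_min le_max lexx.
have vu : v - u <= `|c - p|.
  by rewrite /u /v; case: (leP c p) => h; rewrite ler_normr ?opprB lexx ?orbT.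
have ru : r <= u by rewrite le_min rc.
have vb : v <= b by rewrite ge_max cb.
have := @small_growth_close _ _ _ Tcl Tunb X ( *%R L) u v X_cont Tu Tv uv.
have hx t : T t -> u <= t -> t <= v -> exists dx dg,
    [/\ is_delta_derive T X t dx, is_delta_derive T ( *%R L) t dg, 0 <= dg
      & `|dx| <= dg * `|X t|].
  move=> Tt ut tv; exists (A t *m X t), L; split => //; first exact: solX.
    exact: is_delta_derive_linear.
  rewrite (le_trans (mx_norm_mulmx _ _))// ler_wpM2r// ler_wpM2l//.
  by apply: hK => //; [exact: le_trans ut|exact: le_trans vb].
move=> /(_ hx); rewrite -mulrBr => h.
have Luv : L * (v - u) <= 4^-1.
  have L10 : 0 < L + 1 by rewrite ltr_wpDl.
  have := le_trans vu cp; rewrite ler_pdivlMr// mulrC => /(le_trans _); apply.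
  by rewrite mulrDl mul1r lerDl subr_ge0.
have := h Luv p c Tp Tc.
rewrite Xc subr0 normr0 mulr0 normr_le0 !le_max !ge_min !lexx !orbT/=.
by move=> /(_ isT isT)/eqP.
Qed.

Lemma solution_zero_forward r : T r -> X r = 0 ->
  forall t, T t -> r <= t -> X t = 0.
Proof.
move=> Tr Xr; apply: (time_scale_ind Tcl Tunb Tr Xr).
- move=> t Tt rt tj Xt.
  by rewrite (delta_derive_jump Tunb Tt (solX Tt)) Xt mulmx0 scaler0 addr0.
- move=> t rt [Tt _] Xt; have [b Tb tb] := Tunb (t + 1).
  have rb : r <= b by lra.
  have [d d0 hd] := solution_zero_near Tr Tb rb.
  have m0 : 0 < Num.min d 1 by rewrite lt_min d0 ltr01.
  near=> s => Ts ts.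
  have : `|t - s| < Num.min d 1 by near: s; exact: nbhsx_ballx.
  rewrite lt_min => /andP[/ltW sd]; rewrite ltr_norml => /andP[s1 s2].
  by apply: (hd t s) => //; lra.
- move=> t rt ld hl; have Tt : T t by case: ld.
  have [d d0 hd] := solution_zero_near Tr Tt (ltW rt).
  have m0 : 0 < Num.min d (t - r) by rewrite lt_min d0 subr_gt0.
  have [s [Ts sm st]] := left_dense_adherent ld m0.
  have : t - s < Num.min d (t - r) by lra.
  rewrite lt_min => /andP[sd sr].
  apply: (hd s t) => //; [lra|lra| |apply: hl => //; lra].
  by rewrite distrC ger0_norm ?subr_ge0 ltW.
Unshelve. all: by end_near. Qed.

(** Induction forward on [X t <> 0]: regressivity says that the map
[X t |-> X (sigma t)] across a jump is injective. *)
Lemma solution_zero_backward t r : T t -> T r -> r <= t -> X t = 0 -> X r = 0.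
Proof.
move=> Tt Tr rt Xt; apply: contrapT => Xr; move: Xt; move: t Tt rt.
apply: (time_scale_ind Tcl Tunb Tr Xr).
- move=> t Tt rt tj Xt; rewrite (delta_derive_jump Tunb Tt (solX Tt)) => Xj.
  apply: Xt; rewrite -[X t](mulKmx (Areg Tt)) mulmxDl mul1mx -scalemxAl.
  by rewrite Xj mulmx0.
- move=> t rt [Tt _] Xt; have [b Tb tb] := Tunb (t + 1).
  have rb : r <= b by lra.
  have [d d0 hd] := solution_zero_near Tr Tb rb.
  have m0 : 0 < Num.min d 1 by rewrite lt_min d0 ltr01.
  near=> s => Ts ts Xs; apply: Xt.
  have : `|t - s| < Num.min d 1 by near: s; exact: nbhsx_ballx.
  rewrite lt_min distrC => /andP[/ltW sd]; rewrite ltr_norml => /andP[s1 s2].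
  by apply: (hd s t) => //; lra.
- move=> t rt ld hl Xt; have Tt : T t by case: ld.
  have [d d0 hd] := solution_zero_near Tr Tt (ltW rt).
  have m0 : 0 < Num.min d (t - r) by rewrite lt_min d0 subr_gt0.
  have [s [Ts sm st]] := left_dense_adherent ld m0.
  have : t - s < Num.min d (t - r) by lra.
  rewrite lt_min => /andP[sd sr].
  apply: (hl s) => //; first lra.
  apply: (hd t s) => //; [lra|lra|].
  by rewrite ger0_norm ?subr_ge0 ltW.
Unshelve. all: by end_near. Qed.

End zeros_of_solutions.

(** * Solutions on the whole time scale *)

Section solution_operations.
Variables (R : realType) (n : nat) (T : set R) (A : R -> 'M[R]_n).

Lemma is_delta_derive_mulmxr (k l p : nat) (X : R -> 'M[R]_(k, l))
    (C : 'M[R]_(l, p)) t dX :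
  is_delta_derive T X t dX -> is_delta_derive T (fun s => X s *m C) t (dX *m C).
Proof.
move=> Xd e e0; pose K := l%:R * `|C| + 1.
have K0 : 0 < K by rewrite ltr_wpDl// mulr_ge0.
have eK : 0 < e / K by rewrite divr_gt0.
move: (Xd _ eK); apply: filterS => s + Ts => /(_ Ts).
move: (fjump T t) => j h.
rewrite scalemxAl -!mulmxBl (le_trans (mx_norm_mulmx _ _))//.
rewrite mulrAC (le_trans (ler_wpM2l _ h)) ?mulr_ge0//.
rewrite mulrA ler_wpM2r// mulrA ler_pdivrMr// mulrC ler_wpM2l ?(ltW e0)//.
by rewrite lerDl.
Qed.

Lemma solution_mulmxr (m p : nat) (X : R -> 'M[R]_(n, m)) (C : 'M[R]_(m, p)) :
  delta_solution_mx T A X -> delta_solution_mx T A (fun t => X t *m C).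
Proof. by move=> solX t Tt; rewrite mulmxA; apply/is_delta_derive_mulmxr/solX. Qed.

Lemma solutionB (m : nat) (X Y : R -> 'M[R]_(n, m)) :
  delta_solution_mx T A X -> delta_solution_mx T A Y ->
  delta_solution_mx T A (X \- Y).
Proof.
move=> solX solY t Tt; rewrite /= mulmxBr.
by apply: is_delta_deriveB; [exact: solX|exact: solY].
Qed.

End solution_operations.

Lemma unitmx_inj (F : fieldType) (n : nat) (M : 'M[F]_n) :
  (forall c : 'cV[F]_n, M *m c = 0 -> c = 0) -> M \in unitmx.
Proof.
move=> Minj; rewrite -row_full_unit -cokermx_eq0; apply/eqP/matrixP => i j.
have /matrixP/(_ i ord0) : col j (cokermx M) = 0.
  by apply: Minj; rewrite colE mulmxA mulmx_coker mul0mx.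
by rewrite !mxE.
Qed.

Section restriction.
Variables (R : realType) (T : set R).
Hypotheses (Tcl : closed T) (Tunb : forall M : R, exists2 t, T t & M < t).

(** Solutions for [t >= r] are solutions on the time scale [[r, oo)] of [T]:
the jump operator does not look back, so nothing changes at points [t >= r]
except that the derivative at [r] becomes one-sided. *)
Definition ts_from (r : R) : set R := T `&` [set t | r <= t].

Lemma ts_from_closed r : closed (ts_from r).
Proof. by apply: closedI => //; exact: closed_ge. Qed.

Lemma ts_from_unbounded r (M : R) : exists2 t, ts_from r t & M < t.
Proof.
have [t Tt] := Tunb (Num.max r M); rewrite gt_max => /andP[/ltW rt Mt].
by exists t.
Qed.

Lemma fjump_from r t : r <= t -> fjump (ts_from r) t = fjump T t.
Proof.
move=> rt; rewrite /fjump; congr inf; apply/seteqP; split => s.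
  by move=> [[]].
by move=> [Ts ts]; split => //; split => //=; rewrite (le_trans rt)// ltW.
Qed.

Lemma ts_from_subset r r' : r <= r' -> ts_from r' `<=` ts_from r.
Proof. by move=> rr t [Tt rt]; split => //=; exact: le_trans rr rt. Qed.

Lemma is_delta_derive_from (V : normedModType R) (f : R -> V) r t df :
  r <= t -> is_delta_derive T f t df -> is_delta_derive (ts_from r) f t df.
Proof.
move=> rt fd e e0; rewrite fjump_from//.
by apply: filterS (fd e e0) => s + [Ts _]; exact.
Qed.

Lemma rd_continuous_from (V : normedModType R) (f : R -> V) r :
  rd_continuous T f -> rd_continuous (ts_from r) f.
Proof.
move=> [frd fld]; split => t.
  move=> [[Tt rt] tE]; have /frd : right_dense T t.
    by split => //; rewrite -(fjump_from rt).
  apply: cvg_trans; apply: cvg_app => B BT.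
  have {}BT : nbhs t [set s | T s -> B s] := BT.
  change (nbhs t [set s | ts_from r s -> B s]).
  by apply: filterS BT => s + [Ts _]; exact.
move=> [[Tt rt] [s [Ts rs] st] tE].
have /fld : left_dense T t.
  split => //; first by exists s.
  apply/eqP; rewrite eq_le; apply/andP; split.
    by apply: ge_sup; [exists s|move=> u [_ /ltW]].
  rewrite -[leLHS]tE; apply: ge_sup; first by exists s.
  move=> u [[Tu _] ut]; apply: ub_le_sup => //.
  by exists t => v [_ /ltW].
move=> /cvg_ex[l fl]; apply/cvg_ex; exists l; apply: cvg_trans fl.
apply: cvg_app => B BT.
have {}BT : nbhs t [set s | s < t -> T s -> B s] := BT.
change (nbhs t [set s | s < t -> ts_from r s -> B s]).
by apply: filterS BT => u + ut [Tu _]; exact.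
Qed.

Lemma regressive_from (n : nat) (A : R -> 'M[R]_n) r :
  regressive T A -> regressive (ts_from r) A.
Proof.
by move=> Areg t [Tt rt]; rewrite /graininess fjump_from//; exact: Areg.
Qed.

End restriction.

Section global_solution.
Variables (R : realType) (n : nat) (T : set R) (A : R -> 'M[R]_n).
Hypotheses (Tcl : closed T) (Tunb : forall M : R, exists2 t, T t & M < t).
Hypotheses (Ard : rd_continuous T A) (Areg : regressive T A).

Local Notation Tfrom := (ts_from T).

Lemma solution_uniq (m : nat) r t0 (X Y : R -> 'M[R]_(n, m)) :
  T r -> Tfrom r t0 -> delta_solution_mx (Tfrom r) A X ->
  delta_solution_mx (Tfrom r) A Y -> X t0 = Y t0 ->
  forall t, Tfrom r t -> X t = Y t.
Proof.
move=> Tr Tt0 solX solY XY0 t Tt; have [_ rt0] := Tt0.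
have Trr : Tfrom r r by split => //=.
have cl := @ts_from_closed _ T Tcl r; have un := ts_from_unbounded Tunb r.
have rd := @rd_continuous_from _ T _ A r Ard.
have rg := @regressive_from _ T n A r Areg.
have solD := solutionB solX solY.
apply/eqP; rewrite -subr_eq0; apply/eqP.
apply: (solution_zero_forward cl un rd solD Trr); last 2 first.
- exact: Tt.
- by case: Tt.
apply: (solution_zero_backward cl un rd rg solD Tt0 Trr rt0).
by rewrite /= XY0 subrr.
Qed.

(** The forward solution [Y] from [r] has [Y t0] injective, since [Y t0 c = 0]
propagates back to [c = Y r c = 0]; so it can be normalised at [t0]. *)
Lemma solution_from r t0 : T r -> T t0 -> r <= t0 ->
  exists2 Y : R -> 'M[R]_n, delta_solution_mx (Tfrom r) A Y & Y t0 = 1%:M.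
Proof.
move=> Tr Tt0 rt0.
have Trr : Tfrom r r by split => //=.
have Tt0' : Tfrom r t0 by split.
have cl := @ts_from_closed _ T Tcl r; have un := ts_from_unbounded Tunb r.
have rd := @rd_continuous_from _ T _ A r Ard.
have rg := @regressive_from _ T n A r Areg.
have rmin t : Tfrom r t -> r <= t by case.
have [Y solY Yr] := picard_solution cl un Trr rmin rd.
exists (fun t => Y t *m invmx (Y t0)); first exact: solution_mulmxr.
rewrite mulmxV//; apply: unitmx_inj => c Yc.
have := solution_zero_backward cl un rd rg (solution_mulmxr c solY) Tt0' Trr rt0.
by rewrite Yr mul1mx; apply.
Qed.

(** Gluing: the solutions normalised at [t0] that start at different points
agree where both are defined.  Using the one that starts at [min t t0] to
define [Phi t] covers time scales that are unbounded below. *)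
Lemma global_solution t0 : T t0 ->
  exists2 Phi : R -> 'M[R]_n, delta_solution_mx T A Phi & Phi t0 = 1%:M.
Proof.
move=> Tt0.
have /choice[Y hY] : forall r, exists Y : R -> 'M[R]_n, T r -> r <= t0 ->
    delta_solution_mx (Tfrom r) A Y /\ Y t0 = 1%:M.
  move=> r; have [[Tr rt0]|h] := pselect (T r /\ r <= t0).
    by have [Y ? ?] := solution_from Tr Tt0 rt0; exists Y.
  by exists (cst 0) => Tr rt0; case: h.
pose Phi t := Y (Num.min t t0) t.
have PhiE r t : T r -> r <= t0 -> T t -> r <= t -> Phi t = Y r t.
  move=> Tr rt0 Tt rt; rewrite /Phi; set r' := Num.min t t0.
  have Tr' : T r' by rewrite /r'; case: leP.
  have r't0 : r' <= t0 by rewrite ge_min lexx orbT.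
  have r't : r' <= t by rewrite ge_min lexx.
  have rr' : r <= r' by rewrite le_min rt.
  have [solY Y0] := hY r Tr rt0; have [solY' Y'0] := hY r' Tr' r't0.
  apply: (@solution_uniq n r' t0) => //; last by rewrite Y0.
  move=> s [Ts r's] e e0; have rs := le_trans rr' r's.
  have Tsr : Tfrom r s by split.
  have := solY s Tsr e e0; rewrite !fjump_from//.
  by apply: filterS => u + /(ts_from_subset rr'); exact.
exists Phi; last first.
  by rewrite (PhiE t0 t0)//; case: (hY t0 Tt0 (lexx t0)).
move=> t Tt.
have [r [Tr rt0 rt hr]] : exists r, [/\ T r, r <= t0, r <= t &
    \forall s \near t, T s -> r <= s].
  have [[r1 Tr1 r1t]|h] := pselect (exists2 r, T r & r < t).
    exists (Num.min r1 t0); split; [by case: leP|by rewrite ge_min lexx orbT| |].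
      by rewrite ge_min ltW.
    near=> s => _; rewrite ge_min; apply/orP; left; rewrite ltW//.
    by near: s; exact: lt_nbhsr.
  have hmin s : T s -> t <= s.
    by move=> Ts; rewrite leNgt; apply/negP => st; apply: h; exists s.
  by exists t; split => //; [exact: hmin|near=> s; exact: hmin].
have [solY _] := hY r Tr rt0.
move=> e e0; rewrite (PhiE r t)// (PhiE r (fjump T t))//; last 2 first.
- exact: fjump_in.
- by rewrite (le_trans rt)// le_fjump.
have Ttr : Tfrom r t by split.
have := solY t Ttr e e0; rewrite fjump_from//; apply: filterS2 hr => s rs + Ts.
by rewrite (PhiE r s)// ?rs//; apply; split => //=; exact: rs.
Unshelve. all: by end_near. Qed.

End global_solution.

(** * Equivalence of matrix norms *)

Section norm_equivalence.
Variables (R : realType) (n : nat) (N : 'M[R]_n -> R).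
Hypothesis hN : matrix_norm N.

Let N0 : N 0 = 0.
Proof. by case: hN => _ NZ _; rewrite -(scale0r 0) NZ normr0 mul0r. Qed.

Let NN M : N (- M) = N M.
Proof. by case: hN => _ NZ _; rewrite -scaleN1r NZ normrN1 mul1r. Qed.

Let N_ge0 M : 0 <= N M.
Proof.
case: hN => _ _ ND; have := ND M (- M).
by rewrite subrr N0 NN -mulr2n pmulrn_lge0.
Qed.

Lemma matrix_norm_le : exists2 C : R, 0 <= C & forall M, N M <= C * `|M|.
Proof.
exists (\sum_i \sum_j N (delta_mx i j)) => [|M].
  by do 2 (apply: sumr_ge0 => ? _).
case: hN => _ NZ ND.
have Nsum (I : finType) (F : I -> 'M[R]_n) : N (\sum_i F i) <= \sum_i N (F i).
  elim/big_ind2 : _ => [|x1 x2 y1 y2 h1 h2|//]; first by rewrite N0.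
  by rewrite (le_trans (ND _ _))// lerD.
rewrite [M in N M]matrix_sum_delta (le_trans (Nsum _ _))// mulr_suml.
apply: ler_sum => i _; rewrite (le_trans (Nsum _ _))// mulr_suml.
apply: ler_sum => j _; rewrite NZ mulrC ler_wpM2l//.
exact: entry_le_mx_norm.
Qed.

Lemma matrix_norm_continuous : continuous N.
Proof.
have [C C0 hC] := matrix_norm_le.
move=> M; apply/(@cvgrPdist_le _ _ _ _ (nbhs_filter M)) => e e0.
have d0 : 0 < e / (C + 1) by rewrite divr_gt0// ltr_wpDl.
apply/nbhs_ballP; exists (e / (C + 1)) => // M'.
rewrite -ball_normE /ball_/= ltr_pdivlMr ?ltr_wpDl// => MM'.
have h : N (M - M') <= e.
  rewrite (le_trans (hC _))// (le_trans _ (ltW MM'))// mulrC ler_wpM2l//.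
  by rewrite lerDl.
case: hN => _ _ ND.
have h1 := ND (M - M') M'; rewrite subrK in h1.
have h2 := ND (- (M - M')) M; rewrite NN opprB subrK in h2.
by rewrite ler_norml; apply/andP; split; lra.
Qed.

(** [N] is continuous and does not vanish on the compact unit sphere of the
maximum norm, hence is bounded below there; flattening matrices to row vectors
makes Heine-Borel applicable.  Separating [0] from the image of the sphere
also covers [n = 0], where the sphere is empty and [N] has no minimum on it. *)
Lemma matrix_norm_ge : exists2 c : R, 0 < c & forall M, c * `|M| <= N M.
Proof.
pose S := [set v : 'rV[R]_(n * n) | `|v| = 1].
pose N' (v : 'rV[R]_(n * n)) := N (vec_mx v).
have vec_cont : continuous (@vec_mx R n n).
  move=> v; apply/(@cvgrPdist_le _ _ _ _ (nbhs_filter v)) => e e0.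
  apply/nbhs_ballP; exists e => // w; rewrite -ball_normE /ball_/= => vw.
  rewrite -linearB; apply: mx_norm_le_entries => [|i j]; first exact: ltW.
  by rewrite mxE (le_trans (entry_le_mx_norm _ _ _))// ltW.
have N'c : continuous N'.
  by move=> v; apply: continuous_comp; [exact: vec_cont|exact: matrix_norm_continuous].
have Sc : compact S.
  apply: bounded_closed_compact.
    by exists 1; split => // x x1 v /= ->; rewrite ltW.
  rewrite (_ : S = (fun v : 'rV[R]_(n * n) => `|v|) @^-1` [set 1]) //.
  apply: closed_comp; last exact: closed_eq.
  by move=> v _; exact: norm_continuous.
have /compact_closed Kc : compact (N' @` S).
  apply: continuous_compact => //; exact: continuous_subspaceT.
have K0 : (~` (N' @` S)) 0.
  move=> [v v1 Nv]; case: hN => /(_ _ Nv) + _ _ => v0.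
  have {}v0 : v = 0 by rewrite -(vec_mxK v) v0 linear0.
  by move: v1; rewrite /S/= v0 normr0 => /eqP; rewrite eq_sym oner_eq0.
have /nbhs_ballP[c /= c0 hc] :=
  open_nbhs_nbhs (conj (closed_openC (Kc (@Rhausdorff R))) K0).
exists c => // M.
have MM : `|M| <= `|mxvec M|.
  apply: mx_norm_le_entries => // i j; rewrite -mxvecE; exact: entry_le_mx_norm.
have [M0|M0] := eqVneq (mxvec M) 0.
  move: MM; rewrite M0 normr0 normr_le0 => /eqP ->.
  by rewrite normr0 mulr0 N0.
have M0' : 0 < `|mxvec M| by rewrite normr_gt0.
rewrite (le_trans (ler_wpM2l (ltW c0) MM))// -ler_pdivlMr// mulrC.
have -> : `|mxvec M|^-1 * N M = N' (`|mxvec M|^-1 *: mxvec M).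
  rewrite /N' linearZ/= mxvecK; case: hN => _ -> _.
  by rewrite ger0_norm// invr_ge0.
rewrite leNgt; apply/negP => Nc.
apply: (hc (N' (`|mxvec M|^-1 *: mxvec M))).
  by rewrite /ball/= sub0r normrN ger0_norm// N_ge0.
exists (`|mxvec M|^-1 *: mxvec M) => //.
by rewrite /S/= normrZ normfV normr_id mulVf// gt_eqF.
Qed.

End norm_equivalence.

(** * Improper delta integrals *)

Lemma cvg_near_ext (U : Type) (V : nbhsType) (F : set_system U) {FF : Filter F}
    (f g : U -> V) (l : set_system V) :
  (\forall x \near F, f x = g x) -> g x @[x --> F] `=>` l -> f x @[x --> F] `=>` l.
Proof. by move=> fg; apply: cvg_trans; apply: near_eq_cvg; apply: filterS fg. Qed.

Section improper.
Variables (R : realType) (T : set R).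
Hypotheses (Tcl : closed T) (Tunb : forall M : R, exists2 t, T t & M < t).

Lemma infty_in_proper : ProperFilter (infty_in T).
Proof.
split; last exact: within_filter.
move=> [M [Mr hM]]; have [t Tt Mt] := Tunb M.
exact: hM Mt Tt.
Qed.

Lemma infty_in_ge (M : R) : \forall t \near infty_in T, T t /\ M < t.
Proof. by exists M; split; [exact: num_real|move=> t Mt Tt]. Qed.

Lemma near_infty_from (P : set R) (M : R) : (\forall t \near infty_in T, P t) ->
  exists t0, [/\ T t0, M < t0 & forall t, T t -> t0 <= t -> P t].
Proof.
move=> [M1 [_ h]]; have [t0 Tt0] := Tunb (Num.max M M1).
rewrite gt_max => /andP[Mt M1t]; exists t0; split => // t Tt t0t.
by apply: h => //; exact: lt_le_trans t0t.
Qed.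

(** In terms of an antiderivative [F], the improper integral from [t] is
[L - F t] with [L] the limit of [F]; its derivative and its vanishing at
infinity are read off from this. *)
Lemma delta_integral_oo_spec (V : normedModType R) (f F : R -> V) a : T a ->
  delta_antiderivative T f F -> delta_integral_oo_cvg T f a ->
  exists2 L, F b @[b --> infty_in T] --> L &
    forall t, T t -> delta_integral_oo T f t = L - F t.
Proof.
move=> Ta fF /cvg_ex[I hI]; have PF := infty_in_proper.
have FL : F b @[b --> infty_in T] --> I + F a.
  apply: (cvg_near_ext _ (cvgD hI (cvg_cst (F a)))).
  apply: filterS (infty_in_ge 0) => b [Tb _] /=.
  by rewrite (delta_integralE Tcl Tunb fF)//= subrK.
exists (I + F a) => // t Tt; apply: cvg_lim => //.
apply: (cvg_near_ext _ (cvgB FL (cvg_cst (F t)))).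
apply: filterS (infty_in_ge 0) => b [Tb _] /=.
by rewrite (delta_integralE Tcl Tunb fF).
Qed.

Lemma delta_integral_oo_derive (V : normedModType R) (f F : R -> V) a : T a ->
  delta_antiderivative T f F -> delta_integral_oo_cvg T f a ->
  forall t, T t -> is_delta_derive T (delta_integral_oo T f) t (- f t).
Proof.
move=> Ta fF fcvg t Tt; have [L _ hL] := delta_integral_oo_spec Ta fF fcvg.
have := is_delta_deriveB (@is_delta_derive_cst R V T L t) (fF t Tt).
rewrite sub0r; apply: is_delta_derive_near => //=.
- by rewrite hL.
- by rewrite hL//; exact: fjump_in.
- by near=> s => Ts; rewrite hL.
Unshelve. all: by end_near. Qed.

Lemma delta_integral_oo_cvg0 (V : normedModType R) (f F : R -> V) a : T a ->
  delta_antiderivative T f F -> delta_integral_oo_cvg T f a ->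
  delta_integral_oo T f t @[t --> infty_in T] --> 0.
Proof.
move=> Ta fF fcvg; have [L FL hL] := delta_integral_oo_spec Ta fF fcvg.
have PF := infty_in_proper.
have h : (L - F b) @[b --> infty_in T] --> (0 : V).
  by rewrite -(subrr L); apply: cvgB => //; exact: cvg_cst.
apply: (cvg_near_ext _ h).
by apply: filterS (infty_in_ge 0) => b [Tb _] /=; rewrite hL.
Qed.

Lemma rd_continuous_comp (V W : normedModType R) (h : V -> W) (f : R -> V) :
  continuous h -> rd_continuous T f -> rd_continuous T (h \o f).
Proof.
move=> hc [frd fld]; split => t ht.
  exact: cvg_comp (frd t ht) (hc _).
have /cvg_ex[l fl] := fld t ht; apply/cvg_ex; exists (h l).
exact: cvg_comp fl (hc l).
Qed.

End improper.

(** * Changing the unknown *)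

(** Quotient rule for [z = P^-1 x] in an inverse-free form: the expansion
hypothesis [`|v| <= 2 `|P s v|] transfers every estimate from [P z] to [z] and
takes the place of the continuity of matrix inversion.  The identity behind it
is [P(j)(z(j) - z(s)) = (x(j) - x(s)) - (P(j) - P(s)) z(s)] with
[j = sigma t]. *)
Lemma quotient_delta_derive (R : realType) (n m : nat) (T : set R)
    (P : R -> 'M[R]_n) (x z : R -> 'M[R]_(n, m)) t dP dx dz :
  (forall M : R, exists2 s, T s & M < s) -> closed T -> T t ->
  (forall s, T s -> P s *m z s = x s) ->
  (forall s (v : 'M[R]_(n, m)), T s -> `|v| <= 2 * `|P s *m v|) ->
  is_delta_derive T P t dP -> is_delta_derive T x t dx ->
  P (fjump T t) *m dz = dx - dP *m z t ->
  is_delta_derive T z t dz.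
Proof.
move=> Tunb Tcl Tt Pz Pinv Pd xd Pdz e e0.
have Tj := fjump_in Tcl Tunb t.
have /ts_contP Pc := delta_derive_cont Tunb Tt Pd.
have /ts_contP xc := delta_derive_cont Tunb Tt xd.
(* The three errors come from [x], from [P] and from the continuity of [z]. *)
pose C := 2 * (1 + n%:R * (`|z t| + 1) + n%:R * `|dP|).
have C0 : 0 < C.
  by rewrite mulr_gt0// ltr_wpDr ?mulr_ge0// ltr_wpDr// mulr_ge0// addr_ge0.
pose d := Num.min 1 (e / C).
have d0 : 0 < d by rewrite lt_min ltr01 divr_gt0.
have d1 : d <= 1 by rewrite ge_min lexx.
have dC : d * C <= e by rewrite -ler_pdivlMr// ge_min lexx orbT.
(* [d'] is the tolerance on [P] and [x] that makes [z] continuous within [d]. *)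
pose d' := d / (2 * (1 + n%:R * `|z t|)).
have D0 : 0 < 2 * (1 + n%:R * `|z t|).
  by rewrite mulr_gt0// ltr_wpDr// mulr_ge0.
have d'0 : 0 < d' by rewrite divr_gt0.
have dD : d' * (2 * (1 + n%:R * `|z t|)) = d by rewrite /d' mulfVK// gt_eqF.
move: (Pc _ d'0) (xc _ d'0) (Pd _ d0) (xd _ d0).
move=> h1 h2; apply: filterS3 (filterI h1 h2) => s [{}h1 {}h2] h3 h4 Ts.
move: (h1 Ts) (h2 Ts) (h3 Ts) (h4 Ts) Pdz (Pz _ Tj) (Pinv _ ^~ Tj).
move: (fjump T t) => j {}h1 {}h2 {}h3 {}h4 Pdz Pzj Pinvj.
have zc : `|z s - z t| <= d.
  rewrite (le_trans (Pinv s _ Ts))// mulmxBr Pz//.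
  have -> : x s - P s *m z t = (P t - P s) *m z t - (x t - x s).
    by rewrite mulmxBl Pz// opprB [RHS]addrC addrA subrK.
  rewrite -dD mulrCA ler_wpM2l// (le_trans (ler_normB _ _))//.
  rewrite mulrDr mulr1 [leRHS]addrC lerD// (le_trans (mx_norm_mulmx _ _))//.
  by rewrite mulrAC mulrC ler_wpM2r// mulr_ge0.
have zs : `|z s| <= `|z t| + 1.
  have := ler_normD (z s - z t) (z t); rewrite subrK => /le_trans; apply.
  by rewrite addrC lerD2l (le_trans zc).
rewrite (le_trans (Pinvj _))// mulmxBr mulmxBr Pzj -scalemxAr Pdz.
have -> : x j - P j *m z s - (j - s) *: (dx - dP *m z t) =
    (x j - x s - (j - s) *: dx) - (P j - P s - (j - s) *: dP) *m z s
    - (j - s) *: (dP *m (z s - z t)).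
  rewrite -(Pz s Ts) !mulmxBl mulmxBr -scalemxAl !scalerBr.
  move: (P j *m z s) (P s *m z s) ((j - s) *: dx) ((j - s) *: (dP *m z s))
    ((j - s) *: (dP *m z t)) => a1 a2 a3 a4 a5.
  apply/matrixP => i k; rewrite !mxE; ring.
have k1 := mx_norm_mulmx (P j - P s - (j - s) *: dP) (z s).
have k2 := mx_norm_mulmx dP (z s - z t).
have k3 : `|(j - s) *: (dP *m (z s - z t))| <= `|j - s| * (n%:R * `|dP| * d).
  rewrite normrZ ler_wpM2l// (le_trans k2)// ler_wpM2l// mulr_ge0//.
have k4 : `|(P j - P s - (j - s) *: dP) *m z s|
    <= n%:R * (d * `|j - s|) * (`|z t| + 1).
  rewrite (le_trans k1)// ler_pM// ?mulr_ge0//.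
  by rewrite ler_wpM2l.
apply: (@le_trans _ _ (d * C * `|j - s|)); last by rewrite ler_wpM2r.
have -> : d * C * `|j - s| = 2 * (d * `|j - s| +
    n%:R * (d * `|j - s|) * (`|z t| + 1) + `|j - s| * (n%:R * `|dP| * d)).
  by rewrite /C; ring.
rewrite ler_wpM2l// (le_trans (ler_normB _ _))// lerD//.
by rewrite (le_trans (ler_normB _ _))// lerD.
Qed.

(** A system whose coefficient has total mass at most 1/4 moves its solutions
by at most a third of their initial value; in particular a nonzero solution
has a nonzero limit. *)
Lemma perturbation_limit (R : realType) (n m : nat)
    (T : set R) (z : R -> 'M[R]_(n, m)) (g : R -> R) r :
  closed T -> (forall M : R, exists2 s, T s & M < s) ->
  T r -> (forall t, T t -> r <= t) ->
  (forall t, T t -> ts_cont T z t) ->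
  (forall t, T t -> exists dz dg,
    [/\ is_delta_derive T z t dz, is_delta_derive T g t dg, 0 <= dg
      & `|dz| <= dg * `|z t|]) ->
  cvg (g t @[t --> infty_in T]) ->
  (forall s, T s -> g s - g r <= 4^-1) ->
  exists2 l : 'M[R]_(n, m), z t @[t --> infty_in T] --> l & `|l - z r| <= 3^-1 * `|z r|.
Proof.
move=> Tcl Tunb Tr rmin zc hz /cvg_ex[Lg /cvgrPdist_le gL] g4.
have PF := infty_in_proper Tunb.
have zr p : T p -> `|z p - z r| <= 3^-1 * `|z r|.
  move=> Tp; apply: (@small_growth_close _ _ _ Tcl Tunb z g r p zc Tr Tp (rmin p Tp)).
  - by move=> t Tt _ _; exact: hz.
  - exact: g4.
  - by [].
  - by [].
  - by rewrite rmin// lexx.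
  - by rewrite lexx rmin.
pose M := 2 * `|z r|.
have M0 : 0 <= M by rewrite mulr_ge0.
have zM p : T p -> `|z p| <= M.
  move=> Tp; have := ler_normD (z p - z r) (z r); rewrite subrK.
  by have := zr p Tp; have := normr_ge0 (z r); rewrite /M; lra.
have zg u v : T u -> T v -> u <= v -> `|z v - z u| <= M * (g v - g u).
  move=> Tu Tv uv; rewrite mulrBr.
  apply: (@delta_mvt _ _ _ Tcl Tunb z (M \*: g)) => // t Tt _ _.
  have [dz [dg [zd gd dg0 dzg]]] := hz t Tt.
  exists dz, (M *: dg); split => //; first exact: is_delta_deriveZ.
  by rewrite (le_trans dzg)// mulrC ler_wpM2r// zM.
(* [z] is Cauchy because its increments are at most [M] times those of [g]. *)
have : cvg (z t @[t --> infty_in T]).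
  apply: cauchy_cvg; apply: cauchy_exP => e e0.
  pose d := e / (4 * (M + 1)).
  have M1 : 0 < 4 * (M + 1) by rewrite mulr_gt0// ltr_wpDl.
  have d0 : 0 < d by rewrite divr_gt0.
  have dM : d * (4 * (M + 1)) = e by rewrite /d mulfVK// gt_eqF.
  have [t1 [Tt1 _ ht1]] := near_infty_from Tunb 0 (gL _ d0).
  exists (z t1); exists t1; split => [|t t1t Tt]; first exact: num_real.
  rewrite -ball_normE /ball_/= distrC (le_lt_trans (zg _ _ Tt1 Tt (ltW t1t)))//.
  have := ht1 _ Tt (ltW t1t); have := ht1 _ Tt1 (lexx _).
  rewrite !ler_norml => /andP[h1 h2] /andP[h3 h4].
  have h5 : g t - g t1 <= 2 * d by lra.
  by rewrite (le_lt_trans (ler_wpM2l M0 h5))// -dM; nra.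
move=> /cvg_ex[l zl]; exists l => //.
apply/ler_addgt0Pr => e e0.
move/cvgrPdist_le : zl => /(_ _ e0) /(near_infty_from Tunb 0)[t [Tt _ ht]].
rewrite -[X in `|X - _|](subrK (z t)) -addrA (le_trans (ler_normD _ _))//.
by rewrite [leRHS]addrC lerD// ?zr// ht.
Qed.

(** * Convergence of solutions *)

Lemma sup_infinite_unbounded (R : realType) (T : set R) : sup_infinite T ->
  forall M : R, exists2 t, T t & M < t.
Proof.
move=> Tsup M; apply: contrapT => h.
have : (ereal_sup (EFin @` T) <= M%:E)%E.
  apply: ge_ereal_sup => _ [t Tt <-]; rewrite lee_fin leNgt.
  by apply/negP => Mt; apply: h; exists t.
by rewrite Tsup leye_eq.
Qed.

Lemma cvg_perturbed1 (R : realType) (n : nat) (U : Type) (F : set_system U)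
    {FF : Filter F} (f g : U -> 'M[R]_n) :
  f x @[x --> F] --> (0 : 'M[R]_n) -> g x @[x --> F] --> (0 : 'M[R]_n) ->
  (1%:M - f x + g x) @[x --> F] --> (1%:M : 'M[R]_n).
Proof.
move=> f0 g0.
have h : (1%:M - f x + g x) @[x --> F] --> (1%:M - 0 + 0 : 'M[R]_n).
  by apply: (cvgD _ g0); apply: (cvgB _ f0); exact: cvg_cst.
have E : 1%:M - 0 + 0 = 1%:M :> 'M[R]_n by rewrite subr0 addr0.
by rewrite E in h.
Qed.

(** The value of [A P - P^Delta]: what the first two correction terms do not cancel. *)
Lemma mulmx_residual (R : realType) (n : nat) (M b1 b2 : 'M[R]_n) :
  M *m (1%:M - b1 + b2) - (M - M *m b1) = M *m b2.
Proof. by rewrite mulmxDr mulmxBr mulmx1 addrAC subrr add0r. Qed.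

Section asymptotics.
Variables (R : realType) (n : nat) (N : 'M[R]_n -> R) (T : set R) (a : R).
Variable A : R -> 'M[R]_n.
Hypotheses (hN : matrix_norm N) (Tcl : closed T).
Hypotheses (Tunb : forall M : R, exists2 t, T t & M < t) (Ta : T a).
Hypothesis Ard : rd_continuous T A.

Let B1 := delta_integral_oo T A.
Let AB1 t := A t *m B1 t.
Let B2 := delta_integral_oo T AB1.
Let D t := A t *m B2 t.

Hypotheses (h1 : delta_integral_oo_cvg T A a).
Hypotheses (h2 : delta_integral_oo_cvg T AB1 a).
Hypotheses (h3 : delta_integral_oo_abs_cvg N T D a).

Let P t := 1%:M - B1 t + B2 t.

Let B1_derive t : T t -> is_delta_derive T B1 t (- A t).
Proof.
have [F AF] := rd_antiderivative Tcl Tunb Ard.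
exact: (delta_integral_oo_derive Tcl Tunb Ta AF h1).
Qed.

Let AB1_rd : rd_continuous T AB1.
Proof.
exact: (rd_mulmx Ard (fun t Tt => delta_derive_cont Tunb Tt (B1_derive Tt))).
Qed.

Let B2_derive t : T t -> is_delta_derive T B2 t (- AB1 t).
Proof.
have [F AF] := rd_antiderivative Tcl Tunb AB1_rd.
exact: (delta_integral_oo_derive Tcl Tunb Ta AF h2).
Qed.

Let D_rd : rd_continuous T D.
Proof.
exact: (rd_mulmx Ard (fun t Tt => delta_derive_cont Tunb Tt (B2_derive Tt))).
Qed.

Let P_derive t : T t -> is_delta_derive T P t (A t - AB1 t).
Proof.
move=> Tt; rewrite -[A t]opprK -[- - A t]sub0r.
exact: (is_delta_deriveD
  (is_delta_deriveB (@is_delta_derive_cst _ _ T 1%:M t) (B1_derive Tt))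
  (B2_derive Tt)).
Qed.

Let P_cvg1 : P t @[t --> infty_in T] --> (1%:M : 'M[R]_n).
Proof.
have PF := infty_in_proper Tunb.
have [F1 AF1] := rd_antiderivative Tcl Tunb Ard.
have [F2 AF2] := rd_antiderivative Tcl Tunb AB1_rd.
have B10 := delta_integral_oo_cvg0 Tcl Tunb Ta AF1 h1.
have B20 := delta_integral_oo_cvg0 Tcl Tunb Ta AF2 h2.
exact: cvg_perturbed1 B10 B20.
Qed.

(** Stated for matrices [v] of every width: the invertibility of [P t] needs
columns, and the estimates for [z] the width of the solution. *)
Let P_expanding : exists2 t1, T t1 & forall t, T t -> t1 <= t ->
  forall m (v : 'M[R]_(n, m)), `|v| <= 2 * `|P t *m v|.
Proof.
have d0 : 0 < (2 * (n%:R + 1))^-1 :> R by rewrite invr_gt0 mulr_gt0// ltr_wpDl.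
have PF := infty_in_proper Tunb.
move/cvgrPdist_le : P_cvg1 => /(_ _ d0) /(near_infty_from Tunb 0)[t1 [Tt1 _ ht1]].
exists t1 => // t Tt t1t m v.
have h : `|(1%:M - P t) *m v| <= 2^-1 * `|v|.
  rewrite (le_trans (mx_norm_mulmx _ _))// ler_wpM2r//.
  rewrite (le_trans (ler_wpM2l _ (ht1 t Tt t1t)))//.
  rewrite invfM mulrCA ler_piMr// ler_pdivrMr ?ltr_wpDl// mul1r.
  by rewrite lerDl.
have := ler_normD ((1%:M - P t) *m v) (P t *m v).
by rewrite -mulmxDl subrK mul1mx; lra.
Qed.

(** The second conclusion is the injectivity of the map from values at [t0] to
limits.  The point [t0] does not depend on the solution, which may have any
number of columns. *)
Lemma solutions_converge : exists2 t0, T t0 &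
  forall m (x : R -> 'M[R]_(n, m)), delta_solution_mx T A x ->
    exists2 l : 'M[R]_(n, m), x t @[t --> infty_in T] --> l & l = 0 -> x t0 = 0.
Proof.
have [c c0 hc] := matrix_norm_ge hN.
have ND_rd : rd_continuous T (N \o D).
  by apply: rd_continuous_comp => //; exact: matrix_norm_continuous.
have [G hG] := rd_antiderivative_real Tcl Tunb ND_rd.
have [L GL _] := delta_integral_oo_spec Tcl Tunb Ta hG h3.
have [t1 Tt1 Pexp] := P_expanding.
have PF := infty_in_proper Tunb.
(* [K]: a factor 2 from the inverse of [P], [n] from the norm of a product,
   and [1 / c] from the comparison of norms. *)
pose K := 2 * n%:R / c.
have K0 : 0 <= K by rewrite divr_ge0 ?mulr_ge0// ltW.
(* Two values of [G] within [d] of its limit differ by at most [2 * d], and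
   [K * (2 * d) <= 1 / 4]. *)
pose d := (8 * (K + 1))^-1.
have d0 : 0 < d by rewrite invr_gt0 mulr_gt0// ltr_wpDl.
have dK : d * (8 * (K + 1)) = 1 by rewrite mulVf// mulf_neq0// gt_eqF// ltr_wpDl.
have [t0 [Tt0 t10 ht0]] : exists t0, [/\ T t0, t1 < t0 &
    forall t, T t -> t0 <= t -> `|L - G t| <= d].
  by apply: near_infty_from => //; move/cvgrPdist_le : GL; exact.
exists t0 => // m x solx.
pose T0 := ts_from T t0.
have T0cl : closed T0 by exact: ts_from_closed.
have T0unb := ts_from_unbounded Tunb t0.
have T0t0 : T0 t0 by split => /=.
have Pexp0 s (v : 'M[R]_(n, m)) : T0 s -> `|v| <= 2 * `|P s *m v|.
  by move=> [Ts t0s]; apply: Pexp => //; rewrite (le_trans (ltW t10)).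
have Punit s : T0 s -> P s \in unitmx.
  move=> [Ts t0s]; apply: unitmx_inj => v Pv; apply/eqP; rewrite -normr_le0.
  by rewrite (le_trans (Pexp s Ts (le_trans (ltW t10) t0s) _ v))// Pv normr0 mulr0.
pose z t := invmx (P t) *m x t.
have Pz s : T0 s -> P s *m z s = x s by move=> T0s; rewrite mulKVmx// Punit.
pose dz t := invmx (P (fjump T0 t)) *m (D t *m z t).
have zd t : T0 t -> is_delta_derive T0 z t (dz t).
  move=> T0t; have [Tt t0t] := T0t.
  apply: (quotient_delta_derive T0unb T0cl T0t Pz Pexp0
    (is_delta_derive_from t0t (P_derive Tt))
    (is_delta_derive_from t0t (solx t Tt))).
  rewrite mulKVmx ?Punit//; last exact: fjump_in.
  rewrite -(Pz t T0t) (mulmxA (A t) (P t) (z t)) -mulmxBl; congr (_ *m _).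
  exact: esym (mulmx_residual _ _ _).
have dzb t : T0 t -> `|dz t| <= K * N (D t) * `|z t|.
  move=> T0t; rewrite (le_trans (Pexp0 (fjump T0 t) _ (fjump_in T0cl T0unb t)))//.
  rewrite mulKVmx ?Punit//; last exact: fjump_in.
  rewrite (le_trans (ler_wpM2l _ (mx_norm_mulmx _ _)))// !mulrA ler_wpM2r//.
  rewrite (le_trans _ (ler_wpM2l K0 (hc (D t))))//.
  by rewrite mulrA /K mulfVK// gt_eqF.
have g4 s : T0 s -> K * G s - K * G t0 <= 4^-1.
  move=> [Ts t0s]; rewrite -mulrBr.
  have := ht0 _ Ts t0s; have := ht0 _ Tt0 (lexx _).
  rewrite !ler_norml => /andP[k1 k2] /andP[k3 k4].
  have k5 : G s - G t0 <= 2 * d by lra.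
  by rewrite (le_trans (ler_wpM2l K0 k5))//; nra.
have infE : infty_in T0 = infty_in T.
  apply/seteqP; split => Q [M [_ hQ]].
    exists (Num.max M t0); split => [|s]; first exact: num_real.
    by rewrite /= gt_max => /andP[Ms t0s] Ts; apply: hQ => //; split => //; exact: ltW.
  by exists M; split => [|s Ms [Ts _]]; [exact: num_real|exact: hQ].
have [l zl lz0] : exists2 l : 'M[R]_(n, m),
    z t @[t --> infty_in T0] --> l & `|l - z t0| <= 3^-1 * `|z t0|.
  apply: (@perturbation_limit _ _ _ T0 z (K \*: G)) => //.
  - by move=> t [].
  - by move=> t T0t; exact: (delta_derive_cont T0unb T0t (zd t T0t)).
  - move=> t T0t; have [Tt t0t] := T0t.
    exists (dz t), (K * N (D t)); split; [exact: zd| | |exact: dzb].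
      exact: (is_delta_derive_from t0t (is_delta_deriveZ K (hG t Tt))).
    by rewrite mulr_ge0// (le_trans _ (hc _))// mulr_ge0// ltW.
  - rewrite infE; apply/cvg_ex; exists (K * L).
    by apply: cvgM => //; exact: cvg_cst.
rewrite infE in zl; exists l.
  have h : (P t *m z t) @[t --> infty_in T] --> l.
    by rewrite -[l](mul1mx l); exact: cvg_mulmx P_cvg1 zl.
  apply: (cvg_near_ext _ h).
  apply: filterS (infty_in_ge T t0) => t [Tt /ltW t0t].
  by rewrite Pz//; split.
move=> l0; rewrite l0 sub0r normrN in lz0.
have z0 : `|z t0| <= 0 by have := normr_ge0 (z t0); lra.
by rewrite -(Pz _ T0t0); move: z0; rewrite normr_le0 => /eqP ->; rewrite mulmx0.
Qed.

End asymptotics.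

Theorem theorem3 (R : realType) (n : nat) (N : 'M[R]_n -> R) (T : set R)
    (a : R) (A : R -> 'M[R]_n)
    (hN : matrix_norm N)
    (hT : time_scale T) (hsup : sup_infinite T)
    (hTa : T a) (ha : 0 < a)
    (hrd : rd_continuous T A) (hreg : regressive T A)
    (h1 : delta_integral_oo_cvg T A a)
    (h2 : delta_integral_oo_cvg T
            (fun t => A t *m delta_integral_oo T A t) a)
    (h3 : delta_integral_oo_abs_cvg N T
            (fun t => A t *m delta_integral_oo T
               (fun s => A s *m delta_integral_oo T A s) t) a) :
  class_S T A.
Proof.
have [_ Tcl] := hT; have Tunb := sup_infinite_unbounded hsup.
have PF := infty_in_proper Tunb.
have [t0 Tt0 lim] := solutions_converge hN Tcl Tunb hTa hrd h1 h2 h3.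
split=> [x /lim[l xl _]|c]; first by exists l.
have [Phi solPhi Phi0] := global_solution Tcl Tunb hrd hreg Tt0.
have [L PhiL _] := lim _ _ solPhi.
have Lc p (v : 'M[R]_(n, p)) : (Phi t *m v) @[t --> infty_in T] --> L *m v.
  by apply: cvg_mulmx => //; exact: cvg_cst.
have Lunit : L \in unitmx.
  apply: unitmx_inj => v Lv.
  have [l Phil l0] := lim _ _ (solution_mulmxr v solPhi).
  rewrite -[v]mul1mx -Phi0; apply: l0.
  by rewrite -Lv; exact: cvg_unique Phil (Lc _ v).
exists (fun t => Phi t *m (invmx L *m c)); first exact: solution_mulmxr.
by rewrite -[X in _ --> X](mulKVmx Lunit); exact: Lc.
Qed.
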